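(* Let $D$ be a weakly locally finite division ring, $n\ge1$ a natural number, and $N$ a non-central almost subnormal subgroup of $\mathrm{GL}_n(D)$. Then $N$ contains a non-cyclic free subgroup if one of the following conditions holds: (1) $D$ is non-commutative; (2) $n=1$; (3) $n\ge 2$ and $D$ is not a locally finite field.
   Context: A division ring $D$ is weakly locally finite if every finite subset of $D$ generates a division subring that is finite-dimensional over its own center. A field is locally finite if every subfield generated by finitely many elements is finite. A subgroup $H$ of a group $K$ is almost subnormal in $K$ if there is a chain of subgroups $H=H_r\le H_{r-1}\le\cdots\le H_1=K$ such that for each $1<i\le r$, either $H_i$ is normal in $H_{i-1}$ or $H_i$ has finite index in $H_{i-1}$. Non-central means not contained in the center of $\mathrm{GL}_n(D)$. *)

(* Defs.v *)
From HB Require Import structures.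
From mathcomp Require Import all_boot all_order all_algebra.
Set Implicit Arguments. Unset Strict Implicit. Unset Printing Implicit Defensive.
Import GRing.Theory.
Local Open Scope ring_scope.

Definition is_division_ring (D : unitRingType) : Prop :=
  forall x : D, x != 0 -> x \is a GRing.unit.

Definition is_commutative (D : unitRingType) : Prop :=
  forall x y : D, x * y = y * x.

Definition is_division_subring (D : unitRingType) (P : D -> Prop) : Prop :=
  [/\ P 1,
      (forall x y, P x -> P y -> P (x - y)),
      (forall x y, P x -> P y -> P (x * y)) &
      (forall x, P x -> x != 0 -> P x^-1)].

Definition gen_division_subring (D : unitRingType) (S : seq D) : D -> Prop :=
  fun x => forall P : D -> Prop, is_division_subring P ->
             (forall s, s \in S -> P s) -> P x.

Definition center_of (D : unitRingType) (K : D -> Prop) : D -> Prop :=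
  fun z => K z /\ forall y, K y -> z * y = y * z.

Definition fin_dim_over_center (D : unitRingType) (K : D -> Prop) : Prop :=
  exists b : seq D, (forall i, (i < size b)%N -> K b`_i) /\
    forall x, K x -> exists c : nat -> D,
      (forall i, (i < size b)%N -> center_of K (c i)) /\
      x = \sum_(i < size b) c i * b`_i.

Definition weakly_locally_finite (D : unitRingType) : Prop :=
  forall S : seq D, fin_dim_over_center (gen_division_subring S).

Definition locally_finite_field (D : unitRingType) : Prop :=
  is_commutative D /\
  forall S : seq D, exists l : seq D,
    forall x, gen_division_subring S x <-> x \in l.

Definition inv_pair (D : unitRingType) (n : nat) (x y : 'M[D]_n) : Prop :=
  x *m y = 1%:M /\ y *m x = 1%:M.

Definition GL (D : unitRingType) (n : nat) : 'M[D]_n -> Prop :=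
  fun x => exists y, inv_pair x y.

Definition is_subgroup_GL (D : unitRingType) (n : nat) (H : 'M[D]_n -> Prop) : Prop :=
  [/\ (forall x, H x -> GL x),
      H 1%:M,
      (forall x y, H x -> H y -> H (x *m y)) &
      (forall x, H x -> exists y, H y /\ inv_pair x y)].

Definition normal_in (D : unitRingType) (n : nat) (H K : 'M[D]_n -> Prop) : Prop :=
  forall g g' h, K g -> inv_pair g g' -> H h -> H (g' *m h *m g).

Definition finite_index_in (D : unitRingType) (n : nat) (H K : 'M[D]_n -> Prop) : Prop :=
  exists s : seq 'M[D]_n, (forall g, g \in s -> K g) /\
    forall x, K x -> exists g, g \in s /\ exists h, H h /\ x = g *m h.

Definition almost_subnormal_GL (D : unitRingType) (n : nat) (N : 'M[D]_n -> Prop) : Prop :=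
  exists (r : nat) (H : nat -> 'M[D]_n -> Prop),
    (forall x, H 0%N x <-> GL x) /\
    (forall x, H r x <-> N x) /\
    (forall i, (i <= r)%N -> is_subgroup_GL (H i)) /\
    (forall i, (i < r)%N ->
       (forall x, H i.+1 x -> H i x) /\
       (normal_in (H i.+1) (H i) \/ finite_index_in (H i.+1) (H i))).

Definition non_central_GL (D : unitRingType) (n : nat) (N : 'M[D]_n -> Prop) : Prop :=
  exists x g, N x /\ GL g /\ x *m g <> g *m x.

Fixpoint eval_word (D : unitRingType) (n : nat) (I : Type)
    (f finv : I -> 'M[D]_n) (w : seq (I * bool)) : 'M[D]_n :=
  match w with
  | [::] => 1%:M
  | (i, b) :: w' => (if b then f i else finv i) *m eval_word f finv w'
  end.

Fixpoint reduced_word (I : eqType) (w : seq (I * bool)) : bool :=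
  match w with
  | (i, b) :: (((j, c) :: _) as w') => ~~ ((i == j) && (b != c)) && reduced_word w'
  | _ => true
  end.

Definition has_noncyclic_free_subgroup (D : unitRingType) (n : nat)
    (N : 'M[D]_n -> Prop) : Prop :=
  exists (I : eqType) (f finv : I -> 'M[D]_n),
    (exists i j : I, i != j) /\
    (forall i, N (f i) /\ inv_pair (f i) (finv i)) /\
    (forall w : seq (I * bool), w != [::] -> reduced_word w ->
       eval_word f finv w <> 1%:M).

(* Main.v *)
From HB Require Import structures.
From mathcomp Require Import all_boot all_order all_algebra all_field.
From mathcomp Require Import boolp zify ring.
From mathcomp Require classical_sets.
Require Import Defs.
Set Implicit Arguments. Unset Strict Implicit. Unset Printing Implicit Defensive.
Import GRing.Theory.
Local Open Scope ring_scope.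

(* Every almost subnormal chain from GL_n down to N turns into a word: starting from any x
   in GL_n, repeatedly replacing x by [a, x] (for a fixed a in N) or by a fixed power of x
   ends in N. So it is enough to find two invertible matrices for which the resulting
   elements play ping-pong.

   Shrink D to a finitely generated division subring K, finite-dimensional over its centre
   F, so that A = M_n(K) is a central simple F-algebra. A finitely generated subring R of F
   containing all the relevant coefficients maps to a finite field k with many elements, the
   kernel extends to the ideal I of a valuation ring of F, and the R-lattice of A reduces to
   a finite simple ring B, which is a full matrix ring over a field by Wedderburn's little
   theorem. If e is a rank one idempotent of B and x lifts 1 - e, then x^-1 reduces, after
   scaling, to e, and x^-1 (1 + n) x reduces to n for every n in e B (1 - e). If both y
   and y^-1 reduce to multiples of a rank one nilpotent n with n a n and n a^-1 n nonzero, then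
   [a, y] reduces to a n, a shape which the later steps of the word only conjugate by powers of
   a. A second generator is
   obtained from a conjugate of n, and a reduced word in the two generators reduces to a
   nonzero multiple of some X n Y with X, Y invertible, which is not a scalar. *)

(** * Finite domains *)

(** A power step destroys a nilpotent reduction, whereas a commutator with [a] turns [n] into [a n],
    which is idempotent up to a nonzero scalar; so every word is run with one additional commutator
    in front. That commutator involves [y] and its inverse, hence both need known reductions.
    Inverses usually leave the lattice, and the valuation ring is there to rescale them until they
    are nonzero modulo [I]. Its residue field may however be infinite, while Wedderburn's theorem
    needs a finite ring: only the [R]-lattice is mapped to matrices over [k], and other elements of
    [A] are compared with it modulo [I], up to a factor from [F]. Simplicity has to survive the
    reduction. The coordinate forms of [A] are therefore written as sums of maps [z |-> u z v]; once
    the finitely many [u] and [v] lie in the [R]-lattice, some of these sums still turns a given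
    nonzero element of [B] into a nonzero scalar. A centre that is not locally finite provides a
    nonzero element of the kernel of [R -> k], whose powers are the perturbations that make lifts
    invertible. *)

Lemma finite_domain_comm (A : pzRingType) (e : A) (s : seq A) :
  e \in s -> e != 0 ->
  {in s &, forall x y, x - y \in s} ->
  {in s &, forall x y, x * y \in s} ->
  {in s, forall x, e * x = x} -> {in s, forall x, x * e = x} ->
  {in s &, forall x y, x * y = 0 -> x = 0 \/ y = 0} ->
  {in s &, forall x y, x * y = y * x}.
Proof.
move=> es e0 sB sM e1 e1' dom.
have s0 : 0 \in s by rewrite -(subrr e); apply: sB.
have sN x : x \in s -> - x \in s by move=> xs; rewrite -sub0r; apply: sB.
have sD x y : x \in s -> y \in s -> x + y \in s.
  by move=> xs ys; rewrite -[y]opprK; apply: sB => //; apply: sN.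
(* The list becomes a finite unit ring with unit [e], to which [finDomain_mulrC] applies. A separate
   unit is carried along because corner rings [e B e] are among the applications. *)
pose T := seq_sub s.
pose zero : T := SeqSub s0.
pose one : T := SeqSub es.
pose opp (x : T) : T := SeqSub (sN _ (valP x)).
pose add (x y : T) : T := SeqSub (sD _ _ (valP x) (valP y)).
pose mul (x y : T) : T := SeqSub (sM _ _ (valP x) (valP y)).
have addA : associative add by move=> x y z; apply: val_inj; apply: addrA.
have addC : commutative add by move=> x y; apply: val_inj; apply: addrC.
have add0 : left_id zero add by move=> x; apply: val_inj; apply: add0r.
have addN : left_inverse zero opp add by move=> x; apply: val_inj; apply: addNr.
have mulA : associative mul by move=> x y z; apply: val_inj; apply: mulrA.
have mul1 : left_id one mul by move=> x; apply: val_inj; apply: e1; apply: valP.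
have mul1' : right_id one mul by move=> x; apply: val_inj; apply: e1'; apply: valP.
have mulD : left_distributive mul add by move=> x y z; apply: val_inj; apply: mulrDl.
have mulD' : right_distributive mul add by move=> x y z; apply: val_inj; apply: mulrDr.
have one0 : one != zero by apply/eqP => /(congr1 val) /=; apply/eqP.
pose Zm := GRing.isZmodule.Build T addA addC add0 addN.
pose Z : zmodType := HB.pack T Zm.
pose Rm := GRing.Zmodule_isNzRing.Build Z mulA mul1 mul1' mulD mulD' one0.
pose R : nzRingType := HB.pack Z Rm.
pose unit : pred R := [pred x : R | [exists y : T, (mul y x == one) && (mul x y == one)]].
pose inv (x : R) : R := odflt x [pick y : T | (mul y x == one) && (mul x y == one)].
have invP x : unit x -> mul (inv x) x = one /\ mul x (inv x) = one.
  move=> /existsP [y Hy]; rewrite /inv; case: pickP => [z /andP [/eqP ? /eqP ?] //|].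
  by move=> /(_ y); rewrite Hy.
have mVr : {in unit, left_inverse (1 : R) inv *%R} by move=> x /invP [].
have mrV : {in unit, right_inverse (1 : R) inv *%R} by move=> x /invP [].
have unitP (x y : R) : y * x = 1 /\ x * y = 1 -> unit x.
  by case=> yx xy; apply/existsP; exists y; apply/andP; split; apply/eqP.
have inv0 : {in [predC unit], inv =1 id}.
  move=> x; rewrite inE /= /inv => /existsPn nu.
  by case: pickP => // y; rewrite (negbTE (nu y)).
pose Um := GRing.NzRing_hasMulInverse.Build R mVr mrV unitP inv0.
pose U : finUnitRingType := HB.pack R Um (Finite.on T).
have domU : GRing.integral_domain_axiom U.
  move=> x y xy0.
  have : val (x : T) * val (y : T) = 0.
    by have := congr1 (fun z : T => val z) xy0.
  case/(dom _ _ (valP x) (valP y)) => h; apply/orP; [left|right]; apply/eqP;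
  exact: val_inj.
move=> x y xs ys.
pose x1 : T := SeqSub xs; pose y1 : T := SeqSub ys.
have h : mul x1 y1 = mul y1 x1 by exact: (finDomain_mulrC domU (x1 : U) (y1 : U)).
exact: (congr1 (fun z : T => val z) h).
Qed.

(** * Finite residue fields of finitely generated domains *)

(** A homomorphism on [R] encoded as a total function with arbitrary values elsewhere, so that
    successive adjunctions need no subtypes. *)
Definition hom_on (F k : pzRingType) (R : {pred F}) (f : F -> k) : Prop :=
  [/\ f 1 = 1, {in R &, {morph f : x y / x + y}} & {in R &, {morph f : x y / x * y}}].

Section HomOn.
Variables (F k : nzRingType) (R : subringClosed F) (f : F -> k).
Hypothesis fH : hom_on R f.

Lemma hom_on0 : f 0 = 0.
Proof.
have [_ fD _] := fH; have := fD 0 0 (rpred0 _) (rpred0 _).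
by rewrite addr0 -{1}[f 0]addr0 => /addrI.
Qed.

Lemma hom_onN : {in R, {morph f : x / - x}}.
Proof.
move=> x Rx; have [_ fD _] := fH; apply: (addrI (f x)).
by rewrite -fD ?rpredN // !subrr hom_on0.
Qed.

Lemma hom_onB : {in R &, {morph f : x y / x - y}}.
Proof.
by move=> x y Rx Ry; have [_ fD _] := fH; rewrite fD ?rpredN // hom_onN.
Qed.

Lemma hom_onX n : {in R, {morph f : x / x ^+ n}}.
Proof.
move=> x Rx; have [f1 _ fM] := fH.
by elim: n => [|n IHn]; rewrite ?expr0 // !exprS fM ?rpredX // IHn.
Qed.

Lemma hom_on_sum (I : Type) (s : seq I) (P : pred I) (E : I -> F) :
  (forall i, P i -> E i \in R) ->
  f (\sum_(i <- s | P i) E i) = \sum_(i <- s | P i) f (E i).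
Proof.
move=> RE; have [_ fD _] := fH.
elim: s => [|i s IHs]; first by rewrite !big_nil hom_on0.
rewrite !big_cons; case: ifP => // Pi.
by rewrite fD ?IHs ?RE // rpred_sum.
Qed.

Lemma coef_map_on (p : {poly F}) i : (map_poly f p)`_i = f p`_i.
Proof. by rewrite coef_map_id0 // hom_on0. Qed.

Lemma map_polyD_on : {in polyOver R &, {morph map_poly f : p q / p + q}}.
Proof.
move=> p q /polyOverP Rp /polyOverP Rq; apply/polyP=> i.
by have [_ fD _] := fH; rewrite coefD !coef_map_on coefD fD.
Qed.

Lemma map_polyM_on : {in polyOver R &, {morph map_poly f : p q / p * q}}.
Proof.
move=> p q /polyOverP Rp /polyOverP Rq; apply/polyP=> i.
have [_ _ fM] := fH; rewrite coefM !coef_map_on coefM hom_on_sum.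
  by apply: eq_bigr => j _; rewrite !coef_map_on fM.
by move=> j _; rewrite rpredM.
Qed.

Lemma map_polyZ_on c (p : {poly F}) : c \in R -> p \in polyOver R ->
  map_poly f (c *: p) = f c *: map_poly f p.
Proof.
move=> Rc /polyOverP Rp; have [_ _ fM] := fH; apply/polyP=> i.
by rewrite coefZ !coef_map_on coefZ fM.
Qed.

Lemma map_polyC_on c : map_poly f c%:P = (f c)%:P.
Proof. by apply/polyP=> i; rewrite coef_map_on !coefC; case: eqP => // _; rewrite hom_on0. Qed.

End HomOn.

(** The leading coefficient of [g] need not be invertible in [R]; multiplying by its powers keeps
    quotient and remainder over [R]. *)
Lemma pseudo_division (F : idomainType) (R : subringClosed F) (g p : {poly F}) :
  g \in polyOver R -> g != 0 -> p \in polyOver R ->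
  exists j q r, [/\ q \in polyOver R, r \in polyOver R,
    lead_coef g ^+ j *: p = q * g + r & (size r < size g)%N].
Proof.
move=> Rg g0; have [n] := ubnP (size p).
elim: n p => // n IHn p; rewrite ltnS => le_pn Rp.
have [lt_pg | le_gp] := ltnP (size p) (size g).
  by exists 0%N, 0, p; rewrite expr0 scale1r mul0r add0r rpred0.
have Rlg : lead_coef g \in R by move/polyOverP: Rg; apply.
have Rlp : lead_coef p \in R by move/polyOverP: Rp; apply.
pose m := lead_coef p *: 'X^(size p - size g).
have Rm : m \in polyOver R by rewrite polyOverZ ?rpredX ?polyOverX.
have p0 : p != 0 by rewrite -size_poly_gt0 (leq_trans _ le_gp) // size_poly_gt0.
have szp : (0 < size p)%N by rewrite size_poly_gt0.
have szg : (0 < size g)%N by rewrite size_poly_gt0.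
pose h := lead_coef g *: p - m * g.
have sz : (size h < size p)%N.
  rewrite -(prednK szp) ltnS; apply/leq_sizeP => i le_i.
  rewrite coefB coefZ -scalerAl coefZ coefXnM.
  have -> : (i < size p - size g)%N = false by move: szp szg le_gp le_i; lia.
  have [->|ne_i] := eqVneq i (size p).-1.
    have -> : ((size p).-1 - (size p - size g) = (size g).-1)%N.
      by move: le_gp szp szg; lia.
    by rewrite -!lead_coefE mulrC subrr.
  have lt_i : (size p <= i)%N by move: szp le_i ne_i; lia.
  have lt_g : (size g <= i - (size p - size g))%N by move: le_gp szg lt_i; lia.
  by rewrite (nth_default _ lt_i) (nth_default _ lt_g) !mulr0 subr0.
have [|j [q [r [Rq Rr e szr]]]] := IHn _ (leq_trans sz le_pn).
  by rewrite rpredB ?polyOverZ // rpredM.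
exists j.+1, (q + lead_coef g ^+ j *: m), r; split => //.
  by rewrite rpredD // polyOverZ // rpredX.
rewrite exprSr -scalerA -[lead_coef g *: p](subrK (m * g)) -/h scalerDr e mulrDl.
by rewrite -addrA [r + _]addrC addrA scalerAl.
Qed.

Definition adjoin (F : nzRingType) (R : {pred F}) (x : F) : {pred F} :=
  fun y => `[< exists2 p : {poly F}, p \in polyOver R & y = p.[x] >].

Section Adjoin.
Variables (F : comNzRingType) (R : subringClosed F) (x : F).

Lemma adjoinP y :
  reflect (exists2 p : {poly F}, p \in polyOver R & y = p.[x]) (y \in adjoin R x).
Proof. exact: asboolP. Qed.

Lemma adjoin_horner (p : {poly F}) : p \in polyOver R -> p.[x] \in adjoin R x.
Proof. by move=> Rp; apply/adjoinP; exists p. Qed.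

Fact adjoin_subring : subring_closed (adjoin R x).
Proof.
split=> [|_ _ /adjoinP [p Rp ->] /adjoinP [q Rq ->]|_ _ /adjoinP [p Rp ->] /adjoinP [q Rq ->]].
- by rewrite -[1](hornerC 1 x) adjoin_horner // polyOverC rpred1.
- by rewrite -hornerN -hornerD adjoin_horner // rpredB.
- by rewrite -hornerM adjoin_horner // rpredM.
Qed.

HB.instance Definition _ := GRing.isSubringClosed.Build F (adjoin R x) adjoin_subring.

Lemma adjoin_sub : {subset R <= adjoin R x}.
Proof. by move=> y Ry; rewrite -[y](hornerC y x) adjoin_horner // polyOverC. Qed.

Lemma adjoin_gen : x \in adjoin R x.
Proof. by rewrite -[X in X \in _](hornerX x) adjoin_horner // polyOverX. Qed.

End Adjoin.

Lemma root_in_finite_extension (k : finFieldType) (p : {poly k}) :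
  (1 < size p)%N ->
  exists (k' : finFieldType) (j : {rmorphism k -> k'}) (w : k'), (map_poly j p).[w] = 0.
Proof.
move=> szp; have p0 : p != 0 by rewrite -size_poly_gt0 ltnW.
have [L [rs Dp _]] := FinSplittingFieldFor p0.
have szL : (1 < size (map_poly (in_alg L) p))%N by rewrite size_map_poly.
have := eqp_size Dp; rewrite size_prod_XsubC => sz_rs.
case: rs => [|w rs] in Dp sz_rs; first by rewrite sz_rs in szL.
exists (FinFieldExtType L), (in_alg L), w.
apply/eqP; change (root (map_poly (in_alg L) p) w).
by rewrite (eqp_root Dp) root_prod_XsubC mem_head.
Qed.

Lemma hom_on_comp (F k k' : nzRingType) (R : {pred F}) (f : F -> k) (j : {rmorphism k -> k'}) :
  hom_on R f -> hom_on R (j \o f).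
Proof.
case=> f1 fD fM; split=> [|x y Rx Ry|x y Rx Ry] /=.
- by rewrite f1 rmorph1.
- by rewrite fD // rmorphD.
- by rewrite fM // rmorphM.
Qed.


(** Nonvanishing at a prescribed [s] is what drives the induction: to adjoin an element, the map on
    the smaller ring must not kill certain leading coefficients and constants. *)
Definition residually_finite (F : nzRingType) (R : {pred F}) : Prop :=
  forall s, s \in R -> s != 0 ->
  exists (k : finFieldType) (f : F -> k), hom_on R f /\ f s != 0.

Lemma hom_on_adjoin (F k : comNzRingType) (R : subringClosed F) (x : F) (f : F -> k) (w : k) :
  hom_on R f ->
  (forall p : {poly F}, p \in polyOver R -> p.[x] = 0 -> (map_poly f p).[w] = 0) ->
  exists f' : F -> k, hom_on (adjoin R x) f' /\
    forall p : {poly F}, p \in polyOver R -> f' p.[x] = (map_poly f p).[w].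
Proof.
move=> fH ker.
have [y|f' f'P] := @choice _ _ (fun y z => forall p : {poly F}, p \in polyOver R ->
    y = p.[x] -> z = (map_poly f p).[w]).
  have [[p Rp ->]|no] := pselect (exists2 p : {poly F}, p \in polyOver R & y = p.[x]).
    exists (map_poly f p).[w] => q Rq /eqP; rewrite -subr_eq0 -hornerN -hornerD => /eqP.
    move/(ker _ (rpredB Rp Rq)) => e; have := map_polyD_on fH (rpredB Rp Rq) Rq.
    by rewrite subrK => ->; rewrite hornerD e add0r.
  by exists 0 => p Rp e; case: no; exists p.
exists f'; split; last by move=> p Rp; apply: f'P.
have [f1 fD fM] := fH; split.
- rewrite (f'P _ 1%:P) ?hornerC // ?polyOverC ?rpred1 //.
  by rewrite (map_polyC_on fH) hornerC.
- move=> _ _ /adjoinP [p Rp ->] /adjoinP [q Rq ->].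
  by rewrite !(f'P _ _ _ erefl) // (f'P _ (p + q)) ?rpredD ?hornerD // (map_polyD_on fH) ?hornerD.
- move=> _ _ /adjoinP [p Rp ->] /adjoinP [q Rq ->].
  by rewrite !(f'P _ _ _ erefl) // (f'P _ (p * q)) ?rpredM ?hornerM // (map_polyM_on fH) ?hornerM.
Qed.

Lemma ex_min_size (F : nzRingType) (P : {poly F} -> Prop) :
  (exists p, P p) -> exists p, P p /\ forall q, P q -> (size p <= size q)%N.
Proof.
case=> p0 Pp0.
have ex : exists n, `[< exists2 p : {poly F}, P p & size p = n >].
  by exists (size p0); apply/asboolP; exists p0.
case: (ex_minnP ex) => n /asboolP [p Pp <-] min_p; exists p; split=> // q Pq.
by apply: min_p; apply/asboolP; exists q.
Qed.

(** [f] plays the minimal polynomial of [x], hence is coprime to [S]. A combination [g] of minimal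
    size divides [f] and [S] up to powers of its leading coefficient. It does not vanish at [x]
    since [S] does not; so the cofactor [q] of [f] vanishes there, is at least as large as [f], and
    [g] is constant. *)
Lemma pseudo_bezout (F : fieldType) (R : subringClosed F) (S f : {poly F}) (x : F) :
  S \in polyOver R -> f \in polyOver R -> f != 0 -> f.[x] = 0 -> S.[x] != 0 ->
  (forall g : {poly F}, g \in polyOver R -> g != 0 -> g.[x] = 0 -> (size f <= size g)%N) ->
  exists r T U, [/\ r \in R, r != 0, T \in polyOver R, U \in polyOver R &
    S * T + f * U = r%:P].
Proof.
move=> RS Rf f0 fx Sx min_f.
have S0 : S != 0 by apply: contraNneq Sx => ->; rewrite horner0.
pose ideal g := [/\ g != 0, g \in polyOver R & exists T U : {poly F},
  [/\ T \in polyOver R, U \in polyOver R & g = S * T + f * U]].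
have [|g [[g0 Rg [T [U [RT RU Eg]]]] min_g]] := @ex_min_size _ ideal.
  exists S; split=> //; exists 1, 0.
  by rewrite mulr1 mulr0 addr0 rpred0 rpred1.
pose c := lead_coef g.
have c0 : c != 0 by rewrite lead_coef_eq0.
have dvd h : h \in polyOver R -> (exists T' U' : {poly F},
    [/\ T' \in polyOver R, U' \in polyOver R & h = S * T' + f * U']) ->
    exists i (q : {poly F}), q \in polyOver R /\ c ^+ i *: h = q * g.
  move=> Rh [T' [U' [RT' RU' Eh]]].
  have [i [q [r [Rq Rr e szr]]]] := pseudo_division Rg g0 Rh.
  exists i, q; split=> //; rewrite e.
  have [->|r0] := eqVneq r 0; first by rewrite addr0.
  have Rc : c ^+ i \in R by rewrite rpredX // /c; move/polyOverP: Rg; apply.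
  suff /min_g : ideal r by rewrite leqNgt szr.
  split=> //; exists (c ^+ i *: T' - q * T), (c ^+ i *: U' - q * U).
  split; try by rewrite rpredB ?polyOverZ // rpredM.
  have -> : r = c ^+ i *: h - q * g by rewrite e addrC addKr.
  by rewrite Eh Eg -!mul_polyC; ring.
have [i [q [Rq e]]] : exists i (q : {poly F}), q \in polyOver R /\ c ^+ i *: f = q * g.
  apply: dvd => //; exists 0, 1.
  by rewrite mulr1 mulr0 add0r rpred0 rpred1.
have [i' [q' [Rq' e']]] : exists i (q : {poly F}), q \in polyOver R /\ c ^+ i *: S = q * g.
  apply: dvd => //; exists 1, 0.
  by rewrite mulr1 mulr0 addr0 rpred0 rpred1.
have gx : g.[x] != 0.
  apply: contraNneq Sx => gx; move/(congr1 (horner^~ x)): e' => /eqP.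
  by rewrite hornerZ hornerM gx mulr0 mulf_eq0 expf_eq0 (negbTE c0) andbF.
have qx : q.[x] = 0.
  move/(congr1 (horner^~ x)): e => /esym /eqP.
  by rewrite hornerZ hornerM fx mulr0 mulf_eq0 (negbTE gx) orbF => /eqP.
have q0 : q != 0.
  apply: contraTneq isT => q0; move/eqP: e; rewrite q0 mul0r scaler_eq0.
  by rewrite expf_eq0 (negbTE c0) andbF (negbTE f0).
have := min_f _ Rq q0 qx.
have -> : size f = (size q + size g).-1.
  by rewrite -(size_scale f (expf_neq0 i c0)) e size_mul.
rewrite -subn1 leq_subLR (addnC 1%N) leq_add2l => szg.
have Eg' := size1_polyC szg.
exists g`_0, T, U; split=> //; last by rewrite -Eg -Eg'.
  by move/polyOverP: Rg; apply.
by apply: contraNneq g0 => g0; rewrite Eg' g0.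
Qed.

(** For [x] transcendental over [R] the image of [x] is free and is chosen off the roots of [S]. For
    [x] algebraic it must be a root of the reduced [f], and the Bezout identity with constant [r]
    keeps [S] from vanishing there. *)
Lemma residually_finite_adjoin (F : fieldType) (R : subringClosed F) (x : F) :
  residually_finite R -> residually_finite (adjoin R x).
Proof.
move=> resR _ /adjoinP [S RS ->] Sx0.
have S0 : S != 0 by apply: contraNneq Sx0 => ->; rewrite horner0.
have RlS : lead_coef S \in R by move/polyOverP: RS; apply.
have [alg|transc] := pselect (exists f : {poly F},
    [/\ f \in polyOver R, f != 0 & f.[x] = 0]); last first.
  have [|k [f [fH flS]]] := resR _ RlS; first by rewrite lead_coef_eq0.
  pose Sk := map_poly f S.
  have szSk : (0 < size Sk)%N.
    rewrite size_poly_gt0; apply: contraNneq flS => Sk0.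
    by rewrite lead_coefE -(coef_map_on fH) -/Sk Sk0 coef0.
  (* A root of ['X * Sk - 1] is a point at which [Sk] is invertible; [k] itself may consist of roots
     of [Sk]. *)
  have [|k' [j [w]]] := @root_in_finite_extension k ('X * Sk - 1).
    have szX : size ('X * Sk) = (size Sk).+1.
      by rewrite mulrC size_mulX // -size_poly_gt0.
    by rewrite size_polyDl ?size_polyN ?size_poly1 szX.
  rewrite rmorphB rmorph1 rmorphM /= map_polyX hornerD hornerN hornerM hornerX hornerC.
  move/eqP; rewrite subr_eq0 => /eqP rootw.
  have jfH := hom_on_comp j fH.
  have [|f' [f'H f'P]] := @hom_on_adjoin _ _ R x _ w jfH.
    move=> p Rp px; have -> : p = 0.
      by apply/eqP; apply: contrapT => /negP p0; apply: transc; exists p.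
    by rewrite map_poly0 horner0.
  exists k', f'; split=> //; rewrite f'P //.
  apply: contraTneq isT => e0; move/eqP: rootw.
  have -> : map_poly j Sk = map_poly (j \o f) S.
    by apply/polyP=> i; rewrite coef_map (coef_map_on fH) (coef_map_on jfH).
  by rewrite e0 mulr0 eq_sym oner_eq0.
have [f [[Rf f0 fx] min_f]] := ex_min_size alg.
have [|r [T [U [Rr r0 RT RU bez]]]] := pseudo_bezout RS Rf f0 fx Sx0.
  by move=> g Rg g0 gx; apply: min_f.
have Rlf : lead_coef f \in R by move/polyOverP: Rf; apply.
have [||k [h [hH]]] := resR (lead_coef f * r); first by rewrite rpredM.
  by rewrite mulf_neq0 // lead_coef_eq0.
have [_ _ hM] := hH; rewrite hM // mulf_eq0 => /norP [hlf hr].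
have szf : (1 < size f)%N.
  rewrite ltnNge; apply/negP => /size1_polyC Ef; move: f0 fx.
  by rewrite Ef hornerC polyC_eq0 => /eqP.
have szfk : (1 < size (map_poly h f))%N.
  rewrite ltnNge; apply/negP => /leq_sizeP sz; move: hlf.
  by rewrite lead_coefE -(coef_map_on hH) sz ?eqxx // -ltnS prednK // ltnW.
have [k' [j [w rootw]]] := root_in_finite_extension szfk.
have jhH := hom_on_comp j hH.
have Ejh p : map_poly j (map_poly h p) = map_poly (j \o h) p.
  by apply/polyP=> i; rewrite coef_map (coef_map_on hH) (coef_map_on jhH).
rewrite Ejh in rootw.
have [|h' [h'H h'P]] := @hom_on_adjoin _ _ R x _ w jhH.
  (* Every relation [p] of [x] is a multiple of [f] up to a power of [lead_coef f], by minimality of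
     [f]; that power survives the reduction, so [w] satisfies the relation too. *)
  move=> p Rp px; have [i [q [g [Rq Rg e szg]]]] := pseudo_division Rf f0 Rp.
  have g0 : g = 0.
    apply/eqP; apply: contraLR szg => g0; rewrite -leqNgt; apply: min_f.
    split=> //; move/(congr1 (horner^~ x)): e.
    by rewrite hornerZ px mulr0 hornerD hornerM fx mulr0 add0r.
  move/(congr1 (map_poly (j \o h))): e.
  rewrite g0 addr0 (map_polyM_on jhH) // (map_polyZ_on jhH) ?rpredX //.
  move/(congr1 (horner^~ w))/eqP; rewrite hornerZ hornerM rootw mulr0 mulf_eq0.
  rewrite (hom_onX jhH) // expf_eq0 /= fmorph_eq0 (negbTE hlf) andbF /=.
  by move/eqP.
exists k', h'; split=> //; rewrite h'P //.
apply: contraNneq hr => Sw; move/(congr1 (map_poly (j \o h))): bez.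
rewrite (map_polyD_on jhH) ?rpredM // !(map_polyM_on jhH) // (map_polyC_on jhH).
move/(congr1 (horner^~ w)); rewrite hornerD !hornerM Sw rootw !mul0r addr0 hornerC.
by move/esym/eqP; rewrite /= fmorph_eq0.
Qed.

Definition int_image (F : nzRingType) : {pred F} := fun y => `[< exists m : int, y = m%:~R >].
Arguments int_image : clear implicits.

Fact int_image_subring (F : nzRingType) : subring_closed (int_image F).
Proof.
split=> [|_ _ /asboolP [m ->] /asboolP [n ->]|_ _ /asboolP [m ->] /asboolP [n ->]].
- by apply/asboolP; exists 1.
- by apply/asboolP; exists (m - n); rewrite rmorphB.
- by apply/asboolP; exists (m * n); rewrite rmorphM.
Qed.

HB.instance Definition _ (F : nzRingType) :=
  GRing.isSubringClosed.Build F (int_image F) (int_image_subring F).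

Lemma residually_finite_int (F : fieldType) : residually_finite (int_image F).
Proof.
move=> _ /asboolP [m ->] m0.
have [p [p_pr pm ker]] : exists p, [/\ prime p, m%:~R != 0 :> 'F_p &
    forall n : int, n%:~R = 0 :> F -> n%:~R = 0 :> 'F_p].
  have Fpz p n : prime p -> (n%:~R == 0 :> 'F_p) = (p %| `|n|)%N.
    move=> p_pr; rewrite (dvdn_pcharf (pchar_Fp p_pr)).
    by case: n => n; rewrite ?NegzE ?mulrNz ?oppr_eq0.
  have FFz n : (n%:~R == 0 :> F) = (`|n|%N%:R == 0 :> F).
    by case: n => n; rewrite ?NegzE ?mulrNz ?oppr_eq0.
  have [[p chp]|ch0] := pselect (exists p, p \in [pchar F]).
    have p_pr := pcharf_prime chp; exists p; split=> // [|n /eqP].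
      by rewrite Fpz // (dvdn_pcharf chp) -FFz.
    by rewrite FFz -(dvdn_pcharf chp) -Fpz // => /eqP.
  have [p lt_p p_pr] := prime_above `|m|%N.
  exists p; split=> // [|n /eqP].
    rewrite Fpz //; apply: contraNN m0 => /dvdn_leq h.
    rewrite FFz; case: (posnP `|m|%N) => [->//|/h].
    by rewrite leqNgt lt_p.
  have [/eqP|n0] := eqVneq `|n|%N 0%N; first by rewrite absz_eq0 => /eqP ->.
  rewrite FFz => nz; case: ch0; have n_gt0 : (0 < `|n|)%N by rewrite lt0n.
  have [p' chp'] := natf0_pchar n_gt0 nz.
  by exists p'.
have [f fP] : exists f : F -> 'F_p, forall n : int, f n%:~R = n%:~R.
  have [y|f0 f0P] := @choice F 'F_p (fun y (z : 'F_p) => forall n : int, y = n%:~R -> z = n%:~R).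
    have [[n ->]|no] := pselect (exists n : int, y = n%:~R); last first.
      by exists 0 => n e; case: no; exists n.
    exists n%:~R => n' /eqP; rewrite -subr_eq0 -rmorphB /= => /eqP /ker /eqP.
    by rewrite rmorphB /= subr_eq0 => /eqP.
  by exists f0 => n; apply: f0P.
exists 'F_p, f; rewrite fP; split=> //; split.
- by rewrite (fP 1).
- by move=> _ _ /asboolP [n ->] /asboolP [n' ->]; rewrite -rmorphD /= !fP rmorphD.
- by move=> _ _ /asboolP [n ->] /asboolP [n' ->]; rewrite -rmorphM /= !fP rmorphM.
Qed.

Lemma exists_residually_finite (F : fieldType) (l : seq F) :
  exists R : subringClosed F, {subset l <= R} /\ residually_finite R.
Proof.
elim: l => [|x l [R [lR resR]]].
  by exists (int_image F : subringClosed F); split=> // ; apply: residually_finite_int.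
exists (adjoin R x : subringClosed F); split; last exact: residually_finite_adjoin.
move=> y; rewrite inE => /predU1P [->|/lR]; first exact: adjoin_gen.
exact: adjoin_sub.
Qed.

(** * Extension of places to valuation rings *)

Definition proper_ideal (F : pzRingType) (O I : {pred F}) : Prop :=
  [/\ {subset I <= O}, 0 \in I, 1 \notin I, {in I &, forall x y, x - y \in I} &
      {in O & I, forall x y, x * y \in I}].

Section ProperIdeal.
Variables (F : nzRingType) (O I : {pred F}).
Hypothesis OI : proper_ideal O I.

Lemma ideal0 : 0 \in I. Proof. by case: OI. Qed.

Lemma idealB : {in I &, forall x y, x - y \in I}. Proof. by case: OI. Qed.

Lemma idealM : {in O & I, forall x y, x * y \in I}. Proof. by case: OI. Qed.

Lemma ideal_sub : {subset I <= O}. Proof. by case: OI. Qed.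

Lemma idealN : {in I, forall x, - x \in I}.
Proof. by move=> x Ix; rewrite -sub0r idealB // ideal0. Qed.

Lemma idealD : {in I &, forall x y, x + y \in I}.
Proof. by move=> x y Ix Iy; rewrite -[y]opprK idealB // idealN. Qed.

Lemma ideal_sum (J : Type) (s : seq J) (P : pred J) (E : J -> F) :
  (forall j, P j -> E j \in I) -> \sum_(j <- s | P j) E j \in I.
Proof.
by move=> IE; apply: (big_ind (fun y => y \in I)) => //; [exact: ideal0 | exact: idealD].
Qed.

End ProperIdeal.

Section Chevalley.
Variable F : fieldType.

Definition dominates (O I O' I' : {pred F}) : Prop :=
  {subset O <= O'} /\ {subset I <= I'}.

Section Maximal.
Variables (O : subringClosed F) (I : {pred F}).
Hypothesis OI : proper_ideal O I.
Hypothesis maxO : forall (O' : subringClosed F) (I' : {pred F}),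
  proper_ideal O' I' -> dominates O I O' I' -> dominates O' I' O I.

(** The polynomials with coefficients in [I] give an ideal of [O[x]] containing [I]. By maximality
    of the pair it cannot be proper, so it contains 1. *)
Lemma maximal_notin x : x \notin O ->
  exists p : {poly F}, (forall i, p`_i \in I) /\ p.[x] = 1.
Proof.
move=> Ox; apply: contrapT => no.
pose I' : {pred F} := fun y => `[< exists2 p : {poly F}, (forall i, p`_i \in I) & y = p.[x] >].
have OI' : proper_ideal (adjoin O x) I'.
  split.
  - move=> _ /asboolP [p Ip ->]; apply: adjoin_horner; apply/polyOverP=> i.
    exact: (ideal_sub OI).
  - apply/asboolP; exists 0; last by rewrite horner0.
    by move=> i; rewrite coef0 (ideal0 OI).
  - by apply/negP => /asboolP [p Ip e]; apply: no; exists p.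
  - move=> _ _ /asboolP [p Ip ->] /asboolP [q Iq ->]; apply/asboolP; exists (p - q).
      by move=> i; rewrite coefB (idealB OI).
    by rewrite hornerD hornerN.
  - move=> _ _ /adjoinP [p Op ->] /asboolP [q Iq ->]; apply/asboolP; exists (p * q).
      move=> i; rewrite coefM (ideal_sum OI) // => j _; rewrite (idealM OI) //.
      by move/polyOverP: Op.
    by rewrite hornerM.
have [|sub _] := maxO OI'; last by move/negP: Ox; apply; apply: sub; apply: adjoin_gen.
split; first exact: adjoin_sub.
move=> y Iy; apply/asboolP; exists y%:P; last by rewrite hornerC.
by move=> i; rewrite coefC; case: eqP => // _; apply: (ideal0 OI).
Qed.

(** The ideal [I + u O] is larger than [I], hence contains 1, and [v := u * b] is congruent to 1. If
    [v^-1] were outside [O], multiplying its relation over [I] by a high power of [v] would put that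
    power into [I], although all powers of [v] are congruent to 1. *)
Lemma maximal_unit u : u \in O -> u \notin I -> u^-1 \in O.
Proof.
move=> Ou Iu.
have [i [b [Ii Ob e]]] : exists i b, [/\ i \in I, b \in O & 1 = i + u * b].
  apply: contrapT => no.
  pose J : {pred F} := fun y => `[< exists i b, [/\ i \in I, b \in O & y = i + u * b] >].
  have OJ : proper_ideal O J.
    split.
    - move=> _ /asboolP [i [b [Ii Ob ->]]].
      by rewrite rpredD ?rpredM // (ideal_sub OI).
    - apply/asboolP; exists 0, 0.
      by rewrite mulr0 addr0 rpred0 (ideal0 OI).
    - by apply/negP => /asboolP.
    - move=> _ _ /asboolP [i [b [Ii Ob ->]]] /asboolP [i' [b' [Ii' Ob' ->]]].
      apply/asboolP; exists (i - i'), (b - b'); rewrite (idealB OI) // rpredB //.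
      by split=> //; ring.
    - move=> x _ Ox /asboolP [i [b [Ii Ob ->]]].
      apply/asboolP; exists (x * i), (x * b); rewrite (idealM OI) // rpredM //.
      by split=> //; ring.
  have [|_ sub] := maxO OJ.
    split=> // y Iy; apply/asboolP; exists y, 0.
    by rewrite mulr0 addr0 rpred0.
  move/negP: Iu; apply; apply: sub; apply/asboolP; exists 0, 1.
  by rewrite mulr1 add0r rpred1 (ideal0 OI).
have Oi : i \in O by apply: (ideal_sub OI).
pose v := u * b; have Ov : v \in O by rewrite rpredM.
have Iv : 1 - v \in I by rewrite e addrK.
have IvX k : 1 - v ^+ k \in I.
  elim: k => [|k IHk]; first by rewrite expr0 subrr (ideal0 OI).
  have -> : 1 - v ^+ k.+1 = (1 - v ^+ k) + v ^+ k * (1 - v) by rewrite exprSr; ring.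
  by rewrite (idealD OI) // (idealM OI) // rpredX.
have I1 : 1 \notin I by case: OI.
have vX k : v ^+ k \notin I.
  by apply: contra I1 => Ivk; rewrite -[1](subrK (v ^+ k)) (idealD OI).
have v0 : v != 0.
  by apply: contraNneq (vX 1%N) => v0; rewrite expr1 v0 (ideal0 OI).
have Ov' : v^-1 \in O.
  apply/negPn/negP => /maximal_notin [p [Ip px]].
  move/negP: (vX (size p)); apply.
  rewrite -[v ^+ _]mulr1 -px horner_coef mulr_sumr (ideal_sum OI) // => j _.
  rewrite mulrCA mulrC (idealM OI) // exprVn -expfB ?rpredX //.
have u0 : u != 0 by apply: contraNneq v0 => u0; rewrite /v u0 mul0r.
have -> : u^-1 = b * v^-1.
  have b0 : b != 0 by apply: contraNneq v0 => b0; rewrite /v b0 mulr0.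
  by rewrite /v; field; rewrite u0 b0.
by rewrite rpredM.
Qed.

(** The coefficient [w = 1 - q_0] is a unit of [O], so [x ^+ n] times the relation for [x^-1]
    expresses [x ^+ n] by lower powers of [x] with coefficients in [I]. Substituting this for the
    leading term of [p] shortens the relation for [x]. *)
Lemma relation_reduce x (p q : {poly F}) : x != 0 ->
  (forall i, p`_i \in I) -> (forall i, q`_i \in I) -> p.[x] = 1 -> q.[x^-1] = 1 ->
  (size q <= size p)%N ->
  exists p' : {poly F}, [/\ forall i, p'`_i \in I, p'.[x] = 1 & (size p' < size p)%N].
Proof.
move=> x0 Ip Iq px qx le_qp.
have szp : (0 < size p)%N.
  rewrite size_poly_gt0; apply: contraTneq isT => p0; move/eqP: px.
  by rewrite p0 horner0 eq_sym oner_eq0.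
pose n := (size p).-1; have szp' : size p = n.+1 by rewrite prednK.
pose c := p`_n; pose w := 1 - q`_0.
have I1 : 1 \notin I by case: OI.
have Iw : w \notin I.
  by apply: contra I1 => Iw; rewrite -[1](subrK q`_0) (idealD OI).
have w0 : w != 0 by apply: contraNneq Iw => ->; apply: (ideal0 OI).
have Ow : w \in O by rewrite rpredB ?rpred1 // (ideal_sub OI).
have Ow' := maximal_unit Ow Iw.
have IO := ideal_sub OI.
exists (\poly_(i < n) (p`_i + c * w^-1 * q`_(n - i))); split.
- move=> i; rewrite coef_poly; case: ifP => _; last exact: (ideal0 OI).
  by rewrite (idealD OI) // (idealM OI) // rpredM // /c IO.
- rewrite horner_poly.
  have -> : \sum_(i < n) (p`_i + c * w^-1 * q`_(n - i)) * x ^+ i =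
      \sum_(i < n) p`_i * x ^+ i + c * w^-1 * \sum_(i < n) q`_(n - i) * x ^+ i.
    by rewrite mulr_sumr -big_split; apply: eq_bigr => i _ /=; ring.
  have -> : \sum_(i < n) q`_(n - i) * x ^+ i = w * x ^+ n.
    have := qx; rewrite (@horner_coef_wide _ n.+1); last by rewrite -szp'.
    rewrite big_ord_recl expr0 mulr1 => /(canRL (addKr _)); rewrite addrC -/w => <-.
    rewrite mulr_suml [LHS](reindex_inj rev_ord_inj) /=; apply: eq_bigr => i _.
    rewrite subKn ?ltn_ord // /bump leq0n add1n -mulrA; congr (_ * _).
    have -> : x ^+ n = x ^+ (i.+1) * x ^+ (n - i.+1) by rewrite -exprD subnKC ?ltn_ord.
    by rewrite exprVn mulKf // expf_neq0.
  have := px; rewrite horner_coef szp' big_ord_recr /= => <-.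
  by congr (_ + _); rewrite -/c; field.
- by rewrite szp' ltnS size_poly.
Qed.

Lemma maximal_inv x : x \notin O -> x^-1 \in O.
Proof.
move=> Ox; apply/negPn/negP => Ox'.
have x0 : x != 0 by apply: contraNneq Ox => ->; apply: rpred0.
have [p [[Ip px] min_p]] := ex_min_size (maximal_notin Ox).
have [q [[Iq qx] min_q]] := ex_min_size (maximal_notin Ox').
have [le_qp|/ltnW le_pq] := leqP (size q) (size p).
  have [p' [Ip' p'x]] := relation_reduce x0 Ip Iq px qx le_qp.
  by rewrite ltnNge min_p.
have x0' : x^-1 != 0 by rewrite invr_eq0.
have [|q' [Iq' q'x]] := relation_reduce x0' Iq Ip qx _ le_pq; first by rewrite invrK.
by rewrite ltnNge min_q.
Qed.

Lemma maximal_inv_ideal x : x \notin O -> x^-1 \in I.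
Proof.
move=> Ox; have Ox' := maximal_inv Ox; apply: contraNT Ox => Ix'.
by have := maximal_unit Ox' Ix'; rewrite invrK.
Qed.

End Maximal.

(** Chevalley's extension theorem: Zorn's lemma on the pairs dominating [(R, M)]. Only the inclusion
    of [M] in [I] is kept; that [I] meets [R] exactly in [M] is recovered where [M] is the kernel of
    a map to a finite field. *)
Lemma exists_valuation_ring (R : subringClosed F) (M : {pred F}) :
  proper_ideal R M ->
  exists (O : subringClosed F) (I : {pred F}),
    [/\ proper_ideal O I, {subset R <= O}, {subset M <= I},
        forall x, x \notin O -> x^-1 \in I &
        forall x, x \in O -> x \notin I -> x^-1 \in O].
Proof.
move=> RM.
pose good (t : (F -> bool) * (F -> bool)) :=
  [/\ subring_closed t.1, proper_ideal t.1 t.2 & dominates R M t.1 t.2].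
pose T := {t | good t}.
have t0P : good (R : {pred F}, M).
  by split=> //; [split; [exact: rpred1|exact: rpredB|exact: rpredM] | split].
pose le (s t : T) : bool := `[< dominates (sval s).1 (sval s).2 (sval t).1 (sval t).2 >].
have [||A totA|t max_t] := @classical_sets.ZL_preorder T (exist _ _ t0P) le.
- by move=> t; apply/asboolP; split.
- move=> r s t /asboolP [rs1 rs2] /asboolP [st1 st2]; apply/asboolP.
  by split=> x; [move/rs1/st1 | move/rs2/st2].
- have [[s0 As0]|no] := pselect (exists s, A s); last first.
    by exists (exist _ _ t0P) => s As; case: no; exists s.
  pose O : {pred F} := fun x => `[< exists2 s, A s & (sval s).1 x >].
  pose I : {pred F} := fun x => `[< exists2 s, A s & (sval s).2 x >].
  have OE x : x \in O -> exists2 s, A s & (sval s).1 x by move/asboolP.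
  have IE x : x \in I -> exists2 s, A s & (sval s).2 x by move/asboolP.
  have join s t : A s -> A t -> exists2 r, A r & le s r /\ le t r.
    move=> As At; have [st|ts] := totA s t As At; [exists t | exists s] => //;
    by split=> //; apply/asboolP; split.
  have Oring : subring_closed O.
    split=> [|x y /OE [s As xs] /OE [t At yt]|x y /OE [s As xs] /OE [t At yt]].
    + by apply/asboolP; exists s0 => //; case: (svalP s0) => [[]].
    + have [r Ar [/asboolP [sr _] /asboolP [tr _]]] := join _ _ As At.
      apply/asboolP; exists r => //; case: (svalP r) => [[_ rB _] _ _].
      by apply: rB; [apply: sr | apply: tr].
    + have [r Ar [/asboolP [sr _] /asboolP [tr _]]] := join _ _ As At.
      apply/asboolP; exists r => //; case: (svalP r) => [[_ _ rM] _ _].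
      by apply: rM; [apply: sr | apply: tr].
  have OI : proper_ideal O I.
    split.
    + move=> x /IE [s As xs]; apply/asboolP; exists s => //.
      by case: (svalP s) => _ sI _; apply: (ideal_sub sI).
    + by apply/asboolP; exists s0 => //; case: (svalP s0) => _ sI _; apply: (ideal0 sI).
    + by apply/negP => /IE [s As]; case: (svalP s) => [_ [_ _ /negP]].
    + move=> x y /IE [s As xs] /IE [t At yt].
      have [r Ar [/asboolP [_ sr] /asboolP [_ tr]]] := join _ _ As At.
      apply/asboolP; exists r => //; case: (svalP r) => _ rI _.
      by apply: (idealB rI); [apply: sr | apply: tr].
    + move=> x y /OE [s As xs] /IE [t At yt].
      have [r Ar [/asboolP [sr _] /asboolP [_ tr]]] := join _ _ As At.
      apply/asboolP; exists r => //; case: (svalP r) => _ rI _.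
      by apply: (idealM rI); [apply: sr | apply: tr].
  have tP : good (O, I).
    split=> //; case: (svalP s0) => _ _ [RO MI].
    by split=> x => [/RO|/MI] xs; apply/asboolP; exists s0.
  exists (exist _ _ tP) => s As; apply/asboolP.
  by split=> x xs; apply/asboolP; exists s.
- case: t max_t => [[O I] [/= Oring OI [RO MI]]] max_t.
  pose Oc : subringClosed F := HB.pack (O : {pred F}) (GRing.isSubringClosed.Build F O Oring).
  have maxO (O' : subringClosed F) (I' : {pred F}) :
      proper_ideal O' I' -> dominates Oc I O' I' -> dominates O' I' Oc I.
    move=> OI' dom; have tP : good (O' : {pred F}, I').
      split=> //; first by split; [exact: rpred1|exact: rpredB|exact: rpredM].
      by case: dom => OO' II'; split=> x => [/RO/OO'|/MI/II'].
    by apply/asboolP; apply: (max_t (exist _ _ tP)); apply/asboolP.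
  exists Oc, I; split=> //; first exact: maximal_inv_ideal.
  exact: maximal_unit.
Qed.

End Chevalley.

(** * Artin-Whaples *)

(** The list stands for the sum of the tensors of its pairs, an element of the enveloping ring of
    [A], which acts on [A] from both sides. *)
Definition mulop (A : pzRingType) (l : seq (A * A)) (z : A) : A :=
  \sum_(p <- l) p.1 * z * p.2.

Section Mulop.
Variable A : pzRingType.
Implicit Types (l : seq (A * A)) (x y z : A).

Definition lscale_op x l := [seq (x * p.1, p.2) | p <- l].
Definition rscale_op l x := [seq (p.1, p.2 * x) | p <- l].

Lemma mulop_lscale x l z : mulop (lscale_op x l) z = x * mulop l z.
Proof. by rewrite /mulop big_map mulr_sumr; apply: eq_bigr => p _ /=; rewrite !mulrA. Qed.

Lemma mulop_rscale x l z : mulop (rscale_op l x) z = mulop l z * x.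
Proof. by rewrite /mulop big_map mulr_suml; apply: eq_bigr => p _ /=; rewrite !mulrA. Qed.

Lemma mulop_cat l1 l2 z : mulop (l1 ++ l2) z = mulop l1 z + mulop l2 z.
Proof. exact: big_cat. Qed.

Lemma mulop_flatten (I : Type) (s : seq I) (L : I -> seq (A * A)) z :
  mulop (flatten [seq L i | i <- s]) z = \sum_(i <- s) mulop (L i) z.
Proof. by rewrite /mulop big_flatten big_map. Qed.

Lemma mulop_seq1 x y z : mulop [:: (x, y)] z = x * z * y.
Proof. exact: big_seq1. Qed.

Lemma mulopD l : {morph mulop l : x y / x + y}.
Proof.
move=> x y; rewrite /mulop -big_split; apply: eq_bigr => p _ /=.
by rewrite mulrDr mulrDl.
Qed.

Lemma mulop0 l : mulop l 0 = 0.
Proof. by apply: (addrI (mulop l 0)); rewrite -mulopD !addr0. Qed.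

Lemma mulop_central l c z : (forall y, c * y = y * c) -> mulop l (c * z) = c * mulop l z.
Proof.
move=> cC; rewrite /mulop mulr_sumr; apply: eq_bigr => p _.
by rewrite !mulrA cC.
Qed.

End Mulop.

Definition central (K : pzRingType) (c : K) : Prop := forall y, c * y = y * c.

Definition central_free (K : pzRingType) m (b : 'I_m -> K) : Prop :=
  forall c : 'I_m -> K, (forall i, central (c i)) ->
  \sum_i c i * b i = 0 -> forall i, c i = 0.

Definition central_span (K : pzRingType) m (b : 'I_m -> K) : Prop :=
  forall x, exists c : 'I_m -> K, (forall i, central (c i)) /\ x = \sum_i c i * b i.

Section Central.
Variable K : unitRingType.
Implicit Types c d : K.

Lemma central1 : central (1 : K). Proof. by move=> y; rewrite mul1r mulr1. Qed.

Lemma centralB c d : central c -> central d -> central (c - d).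
Proof. by move=> cC dC y; rewrite mulrBl mulrBr cC dC. Qed.

Lemma centralM c d : central c -> central d -> central (c * d).
Proof. by move=> cC dC y; rewrite -mulrA dC mulrA cC mulrA. Qed.

Lemma centralV c : central c -> central c^-1.
Proof. by move=> cC y; apply/esym/commrV/esym/cC. Qed.

End Central.

(** If every operator killing all [b' i] also killed [bm], the value of any operator at [bm] would
    be the combination of its values at the [b' i] with coefficients [c i]. Operators [L' i]
    followed by left multiplication show that [c i] is central, and the identity operator then shows
    [bm] dependent on the others. *)
Lemma artin_whaples (K : nzRingType) m (b : 'I_m -> K) :
  (forall x : K, x != 0 -> exists y, y * x = 1) ->
  central_free b ->
  exists L : 'I_m -> seq (K * K), forall i j, mulop (L i) (b j) = (i == j)%:R.
Proof.
move=> divK; elim: m b => [|m IHm] b free_b.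
  by exists (fun _ => [::]) => - [].
pose b' i := b (lift ord_max i); pose bm := b ord_max.
have free_b' : central_free b'.
  move=> c cC sum0 i.
  pose c' j := if unlift ord_max j is Some i then c i else 0.
  have := free_b c' _ _ (lift ord_max i); rewrite /c' liftK; apply.
    by move=> j; case: unlift => // y; rewrite mul0r mulr0.
  rewrite (bigD1_ord ord_max) //= unlift_none mul0r add0r -[RHS]sum0.
  by apply: eq_bigr => j _; rewrite liftK.
have [L' L'P] := IHm _ free_b'.
have [T [T0 T1]] : exists T, (forall j, mulop T (b' j) = 0) /\ mulop T bm = 1.
  suff [T [T0 /divK [y Ty]]] : exists T, (forall j, mulop T (b' j) = 0) /\ mulop T bm != 0.
    exists (lscale_op y T); split=> [j|]; last by rewrite mulop_lscale.
    by rewrite mulop_lscale T0 mulr0.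
  apply: contrapT => no.
  have kill T : (forall j, mulop T (b' j) = 0) -> mulop T bm = 0.
    by move=> T0; apply/eqP; apply: contrapT => /negP Tn0; apply: no; exists T.
  pose c i := mulop (L' i) bm.
  have key T : mulop T bm = \sum_i c i * mulop T (b' i).
    (* [T'] is [T] corrected by the dual operators so as to kill every [b' j]. *)
    pose T' := T ++ flatten [seq rscale_op (L' i) (- mulop T (b' i)) | i <- enum 'I_m].
    have T'E z : mulop T' z = mulop T z - \sum_i mulop (L' i) z * mulop T (b' i).
      rewrite mulop_cat mulop_flatten big_enum -sumrN; congr (_ + _).
      by apply: eq_bigr => i _; rewrite mulop_rscale mulrN.
    apply/eqP; rewrite -subr_eq0 -T'E; apply/eqP/kill => j.
    rewrite T'E (bigD1 j) //= L'P eqxx mul1r big1 ?addr0 ?subrr // => i ne_ij.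
    by rewrite L'P (negbTE ne_ij) mul0r.
  have cC i : central (c i).
    move=> x; rewrite [in RHS]/c -mulop_lscale key (bigD1 i) //=.
    rewrite mulop_lscale L'P eqxx mulr1 big1 ?addr0 // => j ne_ji.
    by rewrite mulop_lscale L'P eq_sym (negbTE ne_ji) !mulr0.
  have bmE : bm = \sum_i c i * b' i.
    have := key [:: (1, 1)]; rewrite mulop_seq1 mul1r mulr1 => ->.
    by apply: eq_bigr => i _; rewrite mulop_seq1 mul1r mulr1.
  pose c' j := if unlift ord_max j is Some i then c i else -1.
  have : c' ord_max = 0.
    apply: free_b.
      by rewrite /c' => j; case: unlift => // y; rewrite mulN1r mulrN1.
    rewrite (bigD1_ord ord_max) //= /c' unlift_none mulN1r -/bm bmE.
    rewrite addrC; apply/eqP; rewrite subr_eq0; apply/eqP.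
    by apply: eq_bigr => j _; rewrite liftK.
  by rewrite /c' unlift_none => /eqP; rewrite oppr_eq0 oner_eq0.
exists (fun i => if unlift ord_max i is Some j
                 then L' j ++ rscale_op T (- mulop (L' j) bm) else T).
move=> i j; case: (unliftP ord_max i) => [i' ->|->]; case: (unliftP ord_max j) => [j' ->|->].
- rewrite mulop_cat mulop_rscale L'P T0 mul0r addr0.
  by rewrite (inj_eq lift_inj).
- by rewrite mulop_cat mulop_rscale T1 mul1r subrr eq_sym (negbTE (neq_lift _ _)).
- by rewrite T0 (negbTE (neq_lift _ _)).
- by rewrite T1 eqxx.
Qed.

Lemma central_basis (K : unitRingType) m (b : 'I_m -> K) :
  is_division_ring K -> central_span b ->
  exists m' (b' : 'I_m' -> K), central_span b' /\ central_free b'.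
Proof.
move=> divK span_b.
have ex : exists n, `[< exists b : 'I_n -> K, central_span b >].
  by exists m; apply/asboolP; exists b.
case: (ex_minnP ex) => n /asboolP [b' span_b'] min_n; exists n, b'; split=> //.
move=> c cC sum0 i; apply: contrapT => /eqP ci0.
case: n b' span_b' min_n c cC sum0 i ci0 => [|n] b' span_b' min_n c cC sum0 i ci0.
  by case: i ci0.
suff /asboolP/min_n : exists b : 'I_n -> K, central_span b by rewrite ltnn.
exists (fun j => b' (lift i j)) => x.
have [d [dC ->]] := span_b' x.
exists (fun j => d (lift i j) - d i * (c i)^-1 * c (lift i j)); split.
  move=> j; apply: centralB => //; do !apply: centralM => //.
  exact: centralV.
rewrite (bigD1_ord i) //= in sum0; rewrite (bigD1_ord i) //=.
have -> : b' i = - ((c i)^-1 * \sum_j c (lift i j) * b' (lift i j)).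
  have Uc := divK _ ci0; apply: (mulrI Uc); rewrite mulrN mulVKr //.
  by move/eqP: sum0; rewrite addr_eq0 => /eqP.
rewrite mulrN addrC mulrA mulr_sumr -sumrB; apply: eq_bigr => j _.
by rewrite mulrBl !mulrA.
Qed.

(** * Rank one elements of finite simple rings *)

Lemma mulscalarE (k : fieldType) d c (x : 'M[k]_d) : c%:M * x = c *: x.
Proof. by rewrite -[c%:M * x]/(c%:M *m x) mul_scalar_mx. Qed.

Lemma scalarmulE (k : fieldType) d c (x : 'M[k]_d) : x * c%:M = c *: x.
Proof. by rewrite -[x * c%:M]/(x *m c%:M) mul_mx_scalar. Qed.

Lemma mulscaleL (k : fieldType) d c (x y : 'M[k]_d) : (c *: x) * y = c *: (x * y).
Proof. exact/esym/scalemxAl. Qed.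

Lemma mulscaleR (k : fieldType) d c (x y : 'M[k]_d) : x * (c *: y) = c *: (x * y).
Proof. exact/esym/scalemxAr. Qed.

Section FiniteSimple.
Variables (k : finFieldType) (d m : nat) (B : subringClosed 'M[k]_d).
Variable L : 'I_m -> seq ('M[k]_d * 'M[k]_d).
Hypothesis LB : forall i p, p \in L i -> p.1 \in B /\ p.2 \in B.
Hypothesis Lscalar : forall i z, z \in B -> exists c, mulop (L i) z = c%:M.
Hypothesis Lnondeg : forall z, z \in B -> z != 0 -> exists i, mulop (L i) z != 0.
Implicit Types x y z : 'M[k]_d.

(** Some operator turns a nonzero [y] into a nonzero scalar, while [x] annihilates every term
    [p.1 * y * p.2] of it. *)
Lemma finite_prime x y : x \in B -> y \in B ->
  (forall z, z \in B -> x * z * y = 0) -> x = 0 \/ y = 0.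
Proof.
move=> Bx By xy0; have [->|y0] := eqVneq y 0; [by right | left].
have [i] := Lnondeg By y0; have [c Ec] := Lscalar i By; rewrite Ec => c0.
have : x * mulop (L i) y = 0.
  rewrite /mulop mulr_sumr big_seq big1 // => p /LB [Bp1 _].
  by rewrite !mulrA xy0 // mul0r.
rewrite Ec scalarmulE => /eqP; rewrite scaler_eq0 => /orP [/eqP c_0|/eqP //].
by rewrite c_0 -[0%:M]/(scalar_mx 0) raddf0 eqxx in c0.
Qed.

(** A central [z] factors out of the operator, so it is the quotient of the scalars attached to [z]
    and to 1. *)
Lemma finite_center z : z \in B -> (forall y, y \in B -> z * y = y * z) ->
  exists c, z = c%:M.
Proof.
move=> Bz zC; have [one0|one0] := eqVneq (1 : 'M[k]_d) 0.
  by exists 0; rewrite -[z]mul1r one0 mul0r -[0%:M]/(scalar_mx 0) raddf0.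
have [i] := Lnondeg (rpred1 _) one0.
have [c Ec] := Lscalar i (rpred1 B); have [c' Ec'] := Lscalar i Bz.
rewrite Ec => c0; exists (c^-1 * c').
have : mulop (L i) z = z * mulop (L i) 1.
  rewrite /mulop mulr_sumr !big_seq; apply: eq_bigr => p /LB [Bp1 _].
  by rewrite mulr1 mulrA zC.
have cn0 : c != 0.
  by apply: contraNneq c0 => ->; rewrite -[0%:M]/(scalar_mx 0) raddf0.
rewrite Ec Ec' scalarmulE -scale_scalar_mx => ->.
by rewrite scalerA mulVf // scale1r.
Qed.

(** Brauer's lemma for a right ideal [S B] of least cardinality: left multiplication by [S X] is
    injective on it, and from [S X = S X e] with [e = S y] it follows that [e * e - e] is in the
    kernel. Minimality also makes [e B e] a division ring. *)
Lemma minimal_idempotent : (1 : 'M[k]_d) != 0 ->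
  exists e, [/\ e \in B, e != 0, e * e = e &
    forall x, x \in B -> e * x * e != 0 -> exists2 y, y \in B & e * x * e * y = e].
Proof.
move=> one0; pose rid x := [set x * y | y in [pred y | y \in B]]%SET.
have ridP x z : reflect (exists2 y, y \in B & z = x * y) (z \in rid x).
  by apply: (iffP imsetP) => [[y By ->]|[y By ->]]; exists y.
pose P x := (x \in B) && (x != 0).
have P1 : P 1 by rewrite /P rpred1.
case: (arg_minnP (fun x => #|rid x|) P1) => S /andP [BS S0] minS.
have ridS x : x \in rid S -> x != 0 -> rid x = rid S.
  move=> /ridP [y By Ex] x0; apply/eqP; rewrite eqEcard minS; last first.
    by rewrite /P x0 Ex rpredM.
  rewrite andbT; apply/subsetP => _ /ridP [w Bw ->]; apply/ridP.
  by exists (y * w); rewrite ?rpredM // Ex mulrA.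
have SS : S \in rid S by apply/ridP; exists 1; rewrite ?rpred1 ?mulr1.
have [X BX SXS] : exists2 X, X \in B & S * X * S != 0.
  apply: contrapT => no; have [|e|e] := @finite_prime S S BS BS; last 2 first.
  - by rewrite e eqxx in S0.
  - by rewrite e eqxx in S0.
  by move=> z Bz; apply/eqP; apply: contrapT => /negP h; apply: no; exists z.
have S1S : S * X * S \in rid S.
  by apply/ridP; exists (X * S); rewrite ?rpredM ?mulrA.
have : S * X \in rid (S * X * S) by rewrite ridS //; apply/ridP; exists X.
case/ridP=> y By ES1; pose e := S * y.
have inj u : u \in rid S -> S * X * u = 0 -> u = 0.
  move=> Su Xu; apply/eqP; apply: contrapT => /negP u0.
  have : S \in rid u by rewrite ridS.
  case/ridP=> w Bw ES; move/negP: SXS; apply.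
  by rewrite [X in _ * X]ES mulrA Xu mul0r.
have Se : e \in rid S by apply/ridP; exists y.
have Be : e \in B by rewrite rpredM.
have SXe : S * X = S * X * e by rewrite {1}ES1 /e mulrA.
have ee : e * e = e.
  apply/eqP; rewrite -subr_eq0; apply/eqP/inj.
    apply/ridP; exists (y * e - y); first by rewrite rpredB // rpredM.
    by rewrite mulrBr !mulrA.
  by rewrite mulrBr mulrA -!SXe subrr.
have e0 : e != 0.
  by apply: contraNneq SXS => e0; rewrite SXe e0 mulr0 mul0r.
exists e; split=> // x Bx exe.
have : e \in rid (e * x * e).
  rewrite ridS // /e -!mulrA; apply/ridP.
  by exists (y * (x * (S * y))); rewrite // !rpredM.
by case/ridP => w Bw Ew; exists w.
Qed.

(** The corner [e B e] is commutative by Wedderburn. To see that [t = e x e] is even a [k]-multiple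
    of [e], the operator that makes [e] the scalar [c] is applied to [t]: commutativity gives
    [e z u = c t z] for its value [u], whence [u] commutes with [B] and is a scalar. *)
Lemma rank_one_idempotent : (1 : 'M[k]_d) != 0 ->
  exists e, [/\ e \in B, e != 0, e * e = e &
    forall x, x \in B -> exists c, e * x * e = c *: e].
Proof.
move=> one0; have [e [Be e0 ee div]] := minimal_idempotent one0.
exists e; split=> // x Bx; set t := e * x * e.
pose s := [seq z <- enum 'M[k]_d | (z \in B) && (e * z * e == z)].
have sP z : reflect (z \in B /\ e * z * e = z) (z \in s).
  by rewrite mem_filter mem_enum andbT; apply: (iffP andP) => -[Bz /eqP].
have Bt : t \in B by rewrite !rpredM.
have et : e * t = t by rewrite /t !mulrA ee.
have te : t * e = t by rewrite /t -!mulrA ee.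
have el z : z \in s -> e * z = z by case/sP => _ <-; rewrite !mulrA ee.
have er z : z \in s -> z * e = z by case/sP => _ <-; rewrite -!mulrA ee.
have corner z : z \in B -> e * z * e \in s.
  by move=> Bz; apply/sP; rewrite !rpredM // !mulrA ee -!mulrA ee.
have comm : {in s &, forall y z, y * z = z * y}.
  apply: (@finite_domain_comm _ e) => //.
  - by apply/sP; rewrite ee.
  - move=> y z ys zs; case/sP: (ys) => By _; case/sP: (zs) => Bz _; apply/sP.
    by rewrite rpredB // mulrBr mulrBl !el // !er.
  - move=> y z ys zs; case/sP: (ys) => By _; case/sP: (zs) => Bz _; apply/sP.
    by rewrite rpredM // mulrA el // -mulrA er.
  move=> y z ys zs yz0; have [->|z0] := eqVneq z 0; [by right | left].
  case/sP: (zs) => Bz Ez; case: (div z Bz); first by rewrite Ez.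
  by move=> w _; rewrite Ez => zw; rewrite -[y]er // -zw mulrA yz0 mul0r.
have swap z : z \in B -> e * z * t = t * z * e.
  move=> Bz; have := comm _ _ (corner z Bz) (corner x Bx).
  by rewrite -/t -[e * z * e * t]mulrA et !mulrA te.
have [i] := Lnondeg Be e0; have [c Ec] := Lscalar i Be; rewrite Ec => cn0.
have c0 : c != 0.
  by apply: contraNneq cn0 => ->; rewrite -[0%:M]/(scalar_mx 0) raddf0.
pose u := mulop (L i) t.
have Bu : u \in B.
  by rewrite /u /mulop big_seq rpred_sum // => p /LB [? ?]; rewrite !rpredM.
have eu z : z \in B -> e * z * u = c *: (t * z).
  move=> Bz; rewrite /u -scalarmulE -Ec /mulop !mulr_sumr !big_seq.
  apply: eq_bigr => p /LB [Bp1 _].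
  have Bzp : z * p.1 \in B by rewrite rpredM.
  by have := swap _ Bzp; rewrite !mulrA => ->.
have uC z : z \in B -> u * z = z * u.
  move=> Bz; apply/eqP; rewrite -subr_eq0; apply/eqP.
  case: (@finite_prime e (u * z - z * u)) => // [|w Bw|e_0].
  - by rewrite rpredB ?rpredM.
  - rewrite mulrBr !mulrA eu // -[e * w * z]mulrA eu ?rpredM //.
    by rewrite mulscaleL !mulrA subrr.
  - by rewrite e_0 eqxx in e0.
have [c' Ec'] := finite_center Bu uC; exists (c^-1 * c').
have := eu 1 (rpred1 _); rewrite !mulr1 Ec' scalarmulE => E.
by rewrite -scalerA E scalerA mulVf // scale1r.
Qed.

Variables (a a' g : 'M[k]_d) (t0 : k).
Hypotheses (Ba : a \in B) (Ba' : a' \in B) (Bg : g \in B).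
Hypotheses (aa' : a * a' = 1) (ag : a * g != g * a).
Hypotheses (Bt0 : t0%:M \in B) (t0n0 : t0 != 0) (t0n1 : t0 != 1).

Lemma noncommuting_one_neq0 : (1 : 'M[k]_d) != 0.
Proof. by apply: contraNneq ag => e; rewrite -[a * g]mulr1 -[g * a]mulr1 e !mulr0. Qed.

(* If [a] stabilised the image of every idempotent conjugate to [e] by some [1 + (1 - e) x e],
   it would act on the left ideal [B e] as a scalar. *)
Lemma moved_idempotent : exists e, [/\ e \in B, e != 0, e * e = e,
    forall x, x \in B -> exists c, e * x * e = c *: e & forall c, a * e <> c *: e].
Proof.
have [e [Be e0 ee e1]] := rank_one_idempotent noncommuting_one_neq0.
apply: contrapT => no.
have eigen y : y \in B -> e * y = 0 -> y * e = y -> exists c, a * (e + y) = c *: (e + y).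
  move=> By ey ye; apply: contrapT => nc; apply: no; exists (e + y); split.
  - by rewrite rpredD.
  - apply: contraNneq e0 => ey0; have := congr1 (fun z => e * z) ey0.
    by rewrite /= mulrDr ee ey addr0 mulr0 => ->.
  - have yy : y * y = 0 by rewrite -{1}ye -mulrA ey mulr0.
    by rewrite mulrDl !mulrDr ee ey ye yy !addr0.
  - move=> x Bx; have Bxy : x * (1 + y) \in B by rewrite rpredM // rpredD ?rpred1.
    have [c Ec] := e1 _ Bxy; exists c; have -> : e + y = (1 + y) * e by rewrite mulrDl mul1r ye.
    by rewrite -mulscaleR -Ec !mulrA.
  - by move=> c Ec; apply: nc; exists c.
have [kappa Ek] : exists c, a * e = c *: e.
  by have [|||c] := eigen 0; rewrite ?rpred0 ?mulr0 ?mul0r // addr0; exists c.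
have scal x : x \in B -> a * (x * e) = kappa *: (x * e).
  move=> Bx; pose y := (1 - e) * x * e.
  have By : y \in B by rewrite !rpredM // rpredB // rpred1.
  have ey : e * y = 0 by rewrite /y !mulrA mulrBr mulr1 ee subrr !mul0r.
  have ye : y * e = y by rewrite /y -!mulrA ee.
  have ay : a * y = kappa *: y.
    have [c1 E1] := eigen y By ey ye.
    (* Comparing the eigenvectors [e + y] and [e + t0 y] gives [c2 = c1] and
       [(t0 - 1) (c1 - kappa) = 0]; this is where a scalar other than 0 and 1 is needed. *)
    have [|||c2 E2] := eigen (t0%:M * y).
    - by rewrite rpredM.
    - by rewrite mulscalarE mulscaleR ey scaler0.
    - by rewrite mulscalarE mulscaleL ye.
    have [->|y0] := eqVneq y 0; first by rewrite mulr0 scaler0.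
    have E1' : a * y = (c1 - kappa) *: e + c1 *: y.
      move: E1; rewrite mulrDr Ek scalerDr => /(canRL (addKr _)) ->.
      by rewrite scalerBl addrA (addrC (- _)).
    have proj (c c' : k) : c *: e + c' *: y = 0 -> c = 0 /\ c' = 0.
      move=> E; have : e * (c *: e + c' *: y) = 0 by rewrite E mulr0.
      rewrite mulrDr !mulscaleR ee ey scaler0 addr0 => /eqP.
      rewrite scaler_eq0 (negbTE e0) orbF => /eqP c_0; move: E.
      rewrite c_0 scale0r add0r => /eqP; rewrite scaler_eq0 (negbTE y0) orbF.
      by move/eqP.
    have E : (kappa + t0 * (c1 - kappa) - c2) *: e + (t0 * c1 - c2 * t0) *: y = 0.
      move/eqP: E2; rewrite mulscalarE mulrDr Ek mulscaleR E1' -subr_eq0 => /eqP <-.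
      by rewrite !scalerDr !scalerA opprD (addrA (kappa *: e)) addrACA !scalerBl scalerDl.
    have [Ee Ey] := proj _ _ E.
    have Ec : c2 = c1 by apply: (mulfI t0n0); apply/esym/eqP; rewrite -subr_eq0 [t0 * c2]mulrC Ey.
    have : (t0 - 1) * (c1 - kappa) = 0 by rewrite -Ee Ec; ring.
    move/eqP; rewrite mulf_eq0 !subr_eq0 (negbTE t0n1) => /eqP Ec1.
    by rewrite E1' Ec1 subrr scale0r add0r.
  have -> : x * e = e * x * e + y by rewrite /y mulrBl mul1r mulrBl addrC subrK.
  have [c ->] := e1 x Bx.
  by rewrite mulrDr mulscaleR Ek ay scalerDr !scalerA mulrC.
have := @finite_prime (a * g - g * a) e; case=> //.
- by rewrite rpredB ?rpredM.
- move=> x Bx; rewrite -mulrA mulrBl -!mulrA scal // mulscaleR.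
  by rewrite [g * (x * e)]mulrA scal ?rpredM // subrr.
- by move/eqP; rewrite subr_eq0 (negbTE ag).
- by move=> e_0; rewrite e_0 eqxx in e0.
Qed.

(** With [n = e Q (1 - e)], the product [n a n] is nonzero as soon as [e Q (1 - e) a e] is. The
    factor [(1 - e) a e] is nonzero because [a] moves the image of [e], and then so does [a'], whose
    eigenvectors are eigenvectors of [a]. *)
Lemma moving_nilpotent : exists e n,
  [/\ [/\ e \in B, n \in B, e * e = e, e != 0 & e * n = n], n * e = 0,
      forall x, x \in B -> exists c, e * x * e = c *: e,
      forall x, x \in B -> exists c, n * x * n = c *: n &
      n * a * n != 0 /\ n * a' * n != 0].
Proof.
have [e [Be e0 ee e1 ae]] := moved_idempotent.
have B1 : 1 \in B := rpred1 _.
pose u z := (1 - e) * z * e.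
have Bu z : z \in B -> u z \in B by move=> Bz; rewrite !rpredM // rpredB.
have ua : u a != 0.
  apply/eqP; rewrite /u !mulrBl mul1r => /eqP; rewrite subr_eq0 => /eqP E.
  by have [c Ec] := e1 a Ba; apply: (ae c); rewrite E.
have ua' : u a' != 0.
  apply/eqP; rewrite /u !mulrBl mul1r => /eqP; rewrite subr_eq0 => /eqP E.
  have [c Ec] := e1 a' Ba'; rewrite Ec in E.
  have [c0|c0] := eqVneq c 0.
    move/negP: e0; apply.
    by rewrite -[e]mul1r -aa' -mulrA E c0 scale0r mulr0.
  apply: (ae c^-1); apply: (scalerI c0).
  by rewrite -mulscaleR -E mulrA aa' mul1r scalerA divff // scale1r.
have reach z : z \in B -> z != 0 -> exists2 Q, Q \in B & e * Q * z != 0.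
  move=> Bz z0; apply: contrapT => no.
  have [|E|E] := @finite_prime e z Be Bz; last 2 first.
  - by rewrite E eqxx in e0.
  - by rewrite E eqxx in z0.
  by move=> Q BQ; apply/eqP; apply: contrapT => /negP h; apply: no; exists Q.
(* The [Q] that fail for [a] and those that fail for [a'] form two proper additive subgroups, which
   do not cover [B]: if [Q1] and [Q2] each meet only one condition, their sum meets both. *)
have [Q BQ [Qa Qa']] : exists2 Q, Q \in B & e * Q * u a != 0 /\ e * Q * u a' != 0.
  have [Q1 BQ1 Q1a] := reach _ (Bu _ Ba) ua.
  have [Q2 BQ2 Q2a'] := reach _ (Bu _ Ba') ua'.
  have [Q1a'|?] := eqVneq (e * Q1 * u a') 0; last by exists Q1.
  have [Q2a|?] := eqVneq (e * Q2 * u a) 0; last by exists Q2.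
  exists (Q1 + Q2); first exact: rpredD.
  by rewrite !mulrDr !mulrDl Q1a' Q2a addr0 add0r.
pose n := e * Q * (1 - e).
have ne : n * e = 0 by rewrite /n -mulrA mulrBl mul1r ee subrr mulr0.
have en : e * n = n by rewrite /n !mulrA ee.
have nscal x : x \in B -> exists c, n * x * e = c *: e.
  move=> Bx; have [|c Ec] := e1 (Q * (1 - e) * x); first by rewrite !rpredM // rpredB.
  by exists c; rewrite -Ec /n !mulrA.
have nn x : x \in B -> n * x * e != 0 -> n * x * n != 0.
  move=> Bx; have [c Ec] := nscal x Bx; rewrite Ec => ce0.
  have c0 : c != 0 by apply: contraNneq ce0 => ->; rewrite scale0r.
  have nxn : n * x * n = c *: n by rewrite -{2}en mulrA Ec mulscaleL en.
  rewrite nxn scaler_eq0 negb_or c0; apply: contraNneq ce0 => n0.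
  by rewrite -Ec n0 !mul0r.
exists e, n; split=> //; first by split=> //; rewrite !rpredM // rpredB.
- move=> x Bx; have [c Ec] := nscal x Bx; exists c.
  by rewrite -{2}en mulrA Ec mulscaleL en.
- by split; apply: nn => //; [move: Qa | move: Qa']; rewrite /u /n !mulrA.
Qed.
End FiniteSimple.

(** * Choice of the conjugate used for the second generator *)

Lemma size_mul_le (k : nzRingType) (p q : {poly k}) i j :
  (size p <= i.+1)%N -> (size q <= j.+1)%N -> (size (p * q)%R <= (i + j).+1)%N.
Proof.
move=> sp sq; apply: leq_trans (size_polyMleq _ _) _.
by rewrite -subn1 leq_subLR add1n -addSn -addnS leq_add.
Qed.

Section Conjugator.
Variables (k : fieldType) (d : nat) (B : subringClosed 'M[k]_d).
Variables (a a' n : 'M[k]_d).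
Hypotheses (Ba : a \in B) (Ba' : a' \in B) (Bn : n \in B) (nn : n * n = 0).
Hypothesis nscal : forall x, x \in B -> exists c, n * x * n = c *: n.

Hypotheses (nan : n * a * n != 0) (na'n : n * a' * n != 0).

(** In the application [a'] is the inverse of [a]; then [a n a'] squares to zero and [conj' s i] is
    the inverse of [conj s i]. The index [false] leaves the first generator in place. *)
Let conj (s : k) (i : bool) : 'M[k]_d := if i then 1 + s *: (a * n * a') else 1.
Let conj' (s : k) (i : bool) : 'M[k]_d := if i then 1 - s *: (a * n * a') else 1.

(* Every condition says that a polynomial in [s] of degree at most 2 does not vanish; their
   product is a nonzero polynomial of degree at most 9. *)
Lemma ping_pong_conjugator (S : seq k) : uniq S -> (10 <= size S)%N ->
  exists2 s, s \in S &
  [/\ forall i j, n * (conj' s i * a * conj s j) * n != 0,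
      forall i j, n * (conj' s i * a' * conj s j) * n != 0 &
      forall i j, i != j -> n * (conj' s i * conj s j) * n != 0].
Proof.
move=> uS szS; have n0 : n != 0 by apply: contraNneq nan => ->; rewrite mulr0.
have [r [l nrl]] : exists r l, n r l != 0.
  apply: contrapT => no; move/negP: n0; apply; apply/eqP/matrixP => r l.
  by rewrite mxE; apply/eqP; apply: contrapT => /negP h; apply: no; exists r, l.
(* A linear form with [n x n = mu x *: n] on [B], read off a nonzero entry of [n]. *)
pose mu x := (n * x * n) r l / n r l.
have muE x : x \in B -> n * x * n = mu x *: n.
  move=> Bx; have [c Ec] := nscal Bx.
  by rewrite /mu Ec mxE mulfK.
have mu0 x : mu x != 0 -> n * x * n != 0.
  by apply: contraNneq => E; rewrite /mu E mxE mul0r.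
have mu0' x : x \in B -> n * x * n != 0 -> mu x != 0.
  by move=> Bx; apply: contraNneq => E; rewrite muE // E scale0r.
have muD x y : mu (x + y) = mu x + mu y.
  by rewrite /mu mulrDr mulrDl mxE mulrDl.
have muZ c x : mu (c *: x) = c * mu x.
  by rewrite /mu mulscaleR mulscaleL mxE mulrA.
have muN x : mu (- x) = - mu x.
  by rewrite /mu mulrN mulNr mxE mulNr.
have mu1 : mu 1 = 0 by rewrite /mu mulr1 nn mxE mul0r.
pose c := a * n * a'.
have Bc : c \in B by rewrite !rpredM.
have muc : mu c != 0.
  apply: (mu0') => //; rewrite /c !mulrA muE // mulscaleL mulscaleL -!mulrA mulrA muE //.
  by rewrite !scaler_eq0 !negb_or n0 !mu0'.
pose lin u v : {poly k} := u%:P + v *: 'X.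
pose quad u v w : {poly k} := u%:P + 'X * lin v w.
have linE u v s : (lin u v).[s] = u + s * v.
  by rewrite /lin !hornerE mulrC.
have quadE u v w s : (quad u v w).[s] = u + s * (v + s * w).
  by rewrite /quad hornerD hornerC hornerM hornerX linE.
have lin0 u v : u != 0 -> lin u v != 0.
  move=> u0; apply: contraNneq u0 => E; have := congr1 (horner^~ 0) E.
  by rewrite linE mul0r addr0 horner0 => ->.
have quad0 u v w : u != 0 -> quad u v w != 0.
  move=> u0; apply: contraNneq u0 => E; have := congr1 (horner^~ 0) E.
  by rewrite quadE mul0r addr0 horner0 => ->.
have szlin u v : (size (lin u v) <= 2)%N.
  rewrite (leq_trans (size_polyD _ _)) // geq_max (leq_trans (size_polyC_leq1 _)) //.
  by rewrite (leq_trans (size_scale_leq _ _)) // size_polyX.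
have szquad u v w : (size (quad u v w) <= 3)%N.
  rewrite (leq_trans (size_polyD _ _)) // geq_max (leq_trans (size_polyC_leq1 _)) //.
  by apply: (@size_mul_le _ _ _ 1 1); rewrite ?size_polyX.
pose R x := lin (mu x) (mu (x * c)).
pose L x := lin (mu x) (- mu (c * x)).
pose Q x := quad (mu x) (mu (x * c) - mu (c * x)) (- mu (c * x * c)).
(* All other factors have constant term [mu a] or [mu a']. The factor ['X] serves the last
   condition, where [mu] takes the values [s * mu c] and [- (s * mu c)] with [mu c] nonzero. *)
pose P := 'X * ((R a * L a) * Q a * ((R a' * L a') * Q a')).
have P0 : P != 0.
  by rewrite /P !mulf_neq0 ?polyX_eq0 // ?lin0 ?quad0 ?mu0'.
have szP : (size P <= 10)%N.
  have szh x : (size (R x * L x * Q x)%R <= 5)%N.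
    apply: (@size_mul_le _ _ _ 2 2); last exact: szquad.
    by apply: (@size_mul_le _ _ _ 1 1); exact: szlin.
  apply: (@size_mul_le _ _ _ 1 8); first by rewrite size_polyX.
  by apply: (@size_mul_le _ _ _ 4 4).
have [s Ss Ps] : exists2 s, s \in S & P.[s] != 0.
  apply: contrapT => no; have rootS : all (root P) S.
    apply/allP => s Ss; rewrite /root; apply: contrapT => /negP h.
    by apply: no; exists s.
  have := max_poly_roots P0 rootS uS.
  by rewrite ltnNge (leq_trans szP).
exists s => //.
move: Ps; rewrite /P !hornerM hornerX !mulf_eq0 !negb_or !linE !quadE.
case/andP=> s0 /andP [/andP [/andP [Ra La] Qa] /andP [/andP [Ra' La'] Qa']].
have RE x : mu (x * (1 + s *: c)) = mu x + s * mu (x * c).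
  by rewrite mulrDr mulr1 muD mulscaleR muZ.
have LE x : mu ((1 - s *: c) * x) = mu x + s * - mu (c * x).
  by rewrite mulrDl mul1r muD mulNr muN mulscaleL muZ mulrN.
have QE x : mu ((1 - s *: c) * x * (1 + s *: c)) =
    mu x + s * (mu (x * c) - mu (c * x) + s * - mu (c * x * c)).
  by rewrite RE -[_ * x * c]mulrA !LE [c * (x * c)]mulrA; ring.
have main x : mu x != 0 -> mu x + s * mu (x * c) != 0 -> mu x + s * - mu (c * x) != 0 ->
    mu x + s * (mu (x * c) - mu (c * x) + s * - mu (c * x * c)) != 0 ->
    forall i j, n * (conj' s i * x * conj s j) * n != 0.
  move=> mx Rx Lx Qx i j; apply: mu0; rewrite /conj /conj' -/c.
  by case: i; case: j; rewrite ?mulr1 ?mul1r ?QE ?LE ?RE.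
split; [by apply: main; rewrite ?mu0'| by apply: main; rewrite ?mu0'|].
case=> [] [] // _; apply: mu0; rewrite /conj /conj' -/c ?mulr1 ?mul1r.
  by rewrite -[1 - _]mulr1 LE mu1 mulr1 add0r mulf_neq0 // oppr_eq0.
by rewrite -[1 + _]mul1r RE mu1 mul1r add0r mulf_neq0.
Qed.

End Conjugator.

(** * Ping-pong in a reduction *)

(* Elements of a unit group are represented by pairs [(x, x^-1)]; [None] stands for
   [x |-> [a, x]] and [Some e] for [x |-> x ^ (e + 1)]. *)
Definition step (A : pzRingType) (a a' : A) (p : A * A) (s : option nat) : A * A :=
  if s is Some e then (p.1 ^+ e.+1, p.2 ^+ e.+1)
  else (a * p.1 * a' * p.2, p.1 * a * p.2 * a').

Definition run (A : pzRingType) (a a' : A) (l : seq (option nat)) (p : A * A) : A * A :=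
  foldl (step a a') p l.

Definition inverse_pair (A : pzRingType) (p : A * A) : Prop :=
  p.1 * p.2 = 1 /\ p.2 * p.1 = 1.

Definition word_eval (A : pzRingType) (f : bool -> A * A) (w : seq (bool * bool)) : A :=
  foldr (fun l x => (if l.2 then (f l.1).1 else (f l.1).2) * x) 1 w.

Section PingPong.
Variables (A : pzRingType) (k : fieldType) (d : nat) (Red : A -> 'M[k]_d -> Prop).
Hypothesis RedM : forall x y beta gamma, Red x beta -> Red y gamma -> Red (x * y) (beta * gamma).
Hypothesis RedZ : forall x beta (c : k), c != 0 -> Red x (c *: beta) -> Red x beta.
Hypothesis Red1 : forall beta, Red 1 beta -> exists c : k, beta = c%:M.
Variables (a a' : A) (al al' : 'M[k]_d).
Hypotheses (Ra : Red a al) (Ra' : Red a' al') (alal' : al * al' = 1) (al'al : al' * al = 1).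

Section Run.
Variables (n : 'M[k]_d) (c c' : k).
Hypotheses (nan : n * al * n = c *: n) (na'n : n * al' * n = c' *: n) (c0 : c != 0) (c'0 : c' != 0).

Let conj (j : nat) (x : 'M[k]_d) : 'M[k]_d := al ^+ j * x * al' ^+ j.

Let shape (j : nat) (p : A * A) : Prop :=
  Red p.1 (conj j (al * n)) /\ Red p.2 (conj j (n * al')).

Let conjM j x y : conj j x * conj j y = conj j (x * y).
Proof.
have alVK : al' ^+ j * al ^+ j = 1.
  elim: j => [|j IHj]; first by rewrite !expr0 mulr1.
  by rewrite exprSr exprS mulrA -[_ * al' * al]mulrA al'al mulr1.
by rewrite /conj -!mulrA [X in _ * (_ * X)]mulrA alVK mul1r.
Qed.

Let conj_al j : conj j al = al.
Proof.
rewrite /conj -exprSr exprS -mulrA.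
have -> : al ^+ j * al' ^+ j = 1; last by rewrite mulr1.
elim: j => [|j IHj]; first by rewrite !expr0 mulr1.
by rewrite exprSr exprS mulrA -[_ * al * al']mulrA alal' mulr1.
Qed.

Let conj_al' j : conj j al' = al'.
Proof.
rewrite /conj -mulrA -exprS exprSr mulrA.
have -> : al ^+ j * al' ^+ j = 1; last by rewrite mul1r.
elim: j => [|j IHj]; first by rewrite !expr0 mulr1.
by rewrite exprSr exprS mulrA -[_ * al * al']mulrA alal' mulr1.
Qed.

Let conjZ j (t : k) x : conj j (t *: x) = t *: conj j x.
Proof. by rewrite /conj mulscaleR mulscaleL. Qed.

Let conjS j x : conj j.+1 x = conj j (al * x * al').
Proof. by rewrite /conj exprSr exprS !mulrA. Qed.

Let conj0 x : conj 0 x = x.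
Proof. by rewrite /conj !expr0 mul1r mulr1. Qed.

Lemma Red_expS x (beta : 'M[k]_d) e (t : k) : t != 0 -> beta * beta = t *: beta ->
  Red x beta -> Red (x ^+ e.+1) beta.
Proof.
move=> t0 bb xb; elim: e => [|e IHe]; first by rewrite expr1.
by rewrite exprS; apply: (RedZ t0); rewrite -bb; apply: RedM.
Qed.

(** Both [al n] and [n al'] are idempotent up to the nonzero scalars [c] and [c'], so powers keep
    the shape. In a commutator [al (al n) al' (n al')] collapses to [c'] times the conjugate of
    [al n] by [al], and [j] grows by one. *)
Let step_shape s j p : shape j p -> exists j', shape j' (step a a' p s).
Proof.
case=> R1 R2; case: s => [e|] /=.
  exists j; split=> /=; [apply: (Red_expS _ c0 _ R1) | apply: (Red_expS _ c'0 _ R2)].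
    by rewrite conjM -conjZ mulrA -[al * n * al]mulrA -[al * _ * n]mulrA nan mulscaleR.
  by rewrite conjM -conjZ mulrA na'n mulscaleL.
exists j.+1; split.
  apply: (RedZ c'0); have := RedM (RedM (RedM Ra R1) Ra') R2.
  rewrite -{1}(conj_al j) -{1}(conj_al' j) !conjM -conjZ conjS.
  by rewrite -mulscaleR -na'n !mulrA.
apply: (RedZ c0); have := RedM (RedM (RedM R1 Ra) R2) Ra'.
rewrite -{2}(conj_al j) -{2}(conj_al' j) !conjM -conjZ conjS.
by rewrite -mulscaleL -nan !mulrA.
Qed.

Let run_shape l j p : shape j p -> exists j', shape j' (run a a' l p).
Proof.
elim: l j p => [|s l IHl] j p sp; first by exists j.
by have [j' /IHl] := step_shape s sp.
Qed.

Lemma Red_exp x (beta : 'M[k]_d) e : Red 1 1 -> Red x beta -> Red (x ^+ e) (beta ^+ e).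
Proof.
move=> R11 xb; elim: e => [|e IHe]; first by rewrite !expr0.
by rewrite !exprS; apply: RedM.
Qed.

(** The leading [None] produces the stable shape from the nilpotent [n]. The conjugation by a power
    of [al] accumulated on the way depends on the word and is undone by the outer powers of [a'] and
    [a]. *)
Lemma run_Red (y : A * A) l : Red 1 1 -> Red y.1 n -> Red y.2 n ->
  exists j, Red (a' ^+ j * (run a a' (None :: l) y).1 * a ^+ j) (al * n) /\
            Red (a' ^+ j * (run a a' (None :: l) y).2 * a ^+ j) (n * al').
Proof.
move=> R11 yn y'n; have [|j [s1 s2]] := @run_shape l 0 (step a a' y None).
  rewrite /shape !conj0; split.
    apply: (RedZ c'0); have := RedM (RedM (RedM Ra yn) Ra') y'n.
    by rewrite -mulscaleR -na'n !mulrA.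
  apply: (RedZ c0); have := RedM (RedM (RedM yn Ra) y'n) Ra'.
  by rewrite -mulscaleL -nan.
have alVK i : al' ^+ i * al ^+ i = 1.
  elim: i => [|i IHi]; first by rewrite !expr0 mulr1.
  by rewrite exprSr exprS mulrA -[_ * al' * al]mulrA al'al mulr1.
have back x : al' ^+ j * conj j x * al ^+ j = x.
  by rewrite /conj !mulrA alVK mul1r -mulrA alVK mulr1.
exists j; rewrite -(back (al * n)) -(back (n * al')).
by split; (apply: RedM; last exact: Red_exp); (apply: RedM; first exact: Red_exp).
Qed.

End Run.

(* A reduced word in [z true] and [z false] reduces to a nonzero multiple of [X n Y], with [X] and
   [Y] read off its end letters. *)
Variables (z : bool -> A * A) (q q' : bool -> 'M[k]_d) (n e : 'M[k]_d).
Hypothesis q'q : forall i, q' i * q i = 1.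
Hypothesis z1 : forall i, Red (z i).1 (al * q i * n * q' i).
Hypothesis z2 : forall i, Red (z i).2 (q i * n * (q' i * al')).
Hypothesis nscal : forall i j (x : 'M[k]_d), x \in [:: 1; al; al'] ->
  exists c : k, n * (q' i * x * q j) * n = c *: n.
Hypotheses (nal : forall i j, n * (q' i * al * q j) * n != 0)
  (nal' : forall i j, n * (q' i * al' * q j) * n != 0)
  (n1 : forall i j, i != j -> n * (q' i * q j) * n != 0).
Hypotheses (ne : n * e = 0) (n0 : n != 0) (e0 : e != 0).

Let X (l : bool * bool) := (if l.2 then al else 1) * q l.1.
Let Y (l : bool * bool) := q' l.1 * (if l.2 then 1 else al').

Let letter_Red l : Red (if l.2 then (z l.1).1 else (z l.1).2) (X l * n * Y l).
Proof.
by case: l => i [] /=; rewrite /X /Y /= ?mulr1 ?mul1r.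
Qed.

(** Letters of equal sign meet in [al] or [al'], where any two indices are allowed. Letters of
    opposite sign meet in [q' i * q j], and reducedness is what gives distinct indices there. *)
Let YX l l' : ~~ ((l.1 == l'.1) && (l.2 != l'.2)) ->
  exists2 c : k, c != 0 & n * (Y l * X l') * n = c *: n.
Proof.
case: l l' => i s [j s'] /= red.
have [x [xS E nx]] : exists x, [/\ x \in [:: 1; al; al'],
    Y (i, s) * X (j, s') = q' i * x * q j & n * (q' i * x * q j) * n != 0].
  rewrite /X /Y /=; case: s s' red => [] [] red.
  - by exists al; rewrite !inE eqxx orbT mulr1 mulrA.
  - exists 1; rewrite !inE eqxx !mulr1 !mul1r; split=> //.
    by apply: n1; move: red; rewrite andbT.
  - exists 1; split; first by rewrite !inE eqxx.
      by rewrite mulr1 -mulrA (mulrA al') al'al mul1r.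
    by rewrite mulr1; apply: n1; move: red; rewrite andbT.
  - by exists al'; rewrite !inE eqxx !orbT mul1r.
have [c Ec] := nscal i j xS; rewrite -E in nx Ec; exists c => //.
by apply: contraNneq nx => c0; rewrite Ec c0 scale0r.
Qed.

Lemma word_Red l w : reduced_word (l :: w) ->
  exists l', Red (word_eval z (l :: w)) (X l * n * Y l').
Proof.
elim: w l => [|l2 w IHw] l; first by exists l; rewrite /= mulr1; apply: letter_Red.
case: l => i s; case: l2 => j s'.
rewrite -[reduced_word _]/(~~ ((i == j) && (s != s')) && reduced_word ((j, s') :: w)).
case/andP=> red redw.
have [l' Rw] := IHw _ redw; exists l'.
have [c c0 Ec] := @YX (i, s) (j, s') red.
apply: (RedZ c0).
have <- : X (i, s) * n * Y (i, s) * (X (j, s') * n * Y l') = c *: (X (i, s) * n * Y l').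
  by rewrite -mulscaleL -mulscaleR -Ec !mulrA.
exact: RedM (letter_Red (i, s)) Rw.
Qed.

(** A scalar equal to [X n Y] would be zero, since [n] annihilates [e]; then [n] would be zero, as
    [X] and [Y] can be cancelled. *)
Lemma word_neq1 w : w != [::] -> reduced_word w -> word_eval z w <> 1.
Proof.
case: w => // l w _ red E; have [l'] := word_Red red; rewrite E => /Red1 [c Ec].
have [X' XX'] : exists X', X' * X l = 1.
  case: l {red E Ec} => i s; rewrite /X /=; case: s.
    by exists (q' i * al'); rewrite -mulrA (mulrA al') al'al mul1r.
  by exists (q' i); rewrite mul1r.
have [Y' YY'] : exists Y', Y l' * Y' = 1.
  case: l' {Ec} => i s; rewrite /Y /=; case: s.
    by exists (q i); rewrite mulr1.
  by exists (al * q i); rewrite -mulrA (mulrA al') al'al mul1r.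
have cY' : c *: (Y' * e) = 0.
  rewrite -mulscalarE -Ec.
  have -> : X l * n * Y l' * (Y' * e) = X l * (n * ((Y l' * Y') * e)) by rewrite !mulrA.
  by rewrite YY' mul1r ne mulr0.
have c_0 : c = 0.
  move/eqP: cY'; rewrite scaler_eq0 => /orP [/eqP //|/eqP Ye].
  by move/negP: e0; case; apply/eqP; rewrite -[e]mul1r -YY' -mulrA Ye mulr0.
move/negP: n0; apply; apply/eqP.
have : X' * (X l * n * Y l') * Y' = n.
  have -> : X' * (X l * n * Y l') * Y' = (X' * X l) * (n * (Y l' * Y')) by rewrite !mulrA.
  by rewrite XX' mul1r YY' mulr1.
by rewrite Ec c_0 -[0%:M]/(scalar_mx 0) raddf0 mulr0 mul0r.
Qed.

End PingPong.

(** * Reduction modulo a valuation ideal *)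

Section Lattice.
Variables (F : fieldType) (A : algType F) (d : nat) (b : 'I_d -> A).
Variables (L : 'I_d -> seq (A * A)) (zeta : A -> 'I_d -> F).
Hypothesis zeta_span : forall z, z = \sum_j zeta z j *: b j.
Hypothesis zeta_op : forall z j, mulop (L j) z = (zeta z j)%:A.
Hypothesis zeta_b : forall i j, zeta (b i) j = (i == j)%:R.
Implicit Types (x y z w : A) (c : F).

Lemma scalar_inj c c' : c%:A = c'%:A :> A -> c = c'.
Proof.
move=> /eqP; rewrite -subr_eq0 -scalerBl scaler_eq0 oner_eq0 orbF subr_eq0.
by move/eqP.
Qed.

(** Linearity of the coordinates is inherited from the operators that compute them. *)
Lemma zetaD z w j : zeta (z + w) j = zeta z j + zeta w j.
Proof. by apply: scalar_inj; rewrite -zeta_op mulopD !zeta_op scalerDl. Qed.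

Lemma zetaZ c z j : zeta (c *: z) j = c * zeta z j.
Proof.
apply: scalar_inj; rewrite -zeta_op -[c *: z]mulr_algl mulop_central.
  by rewrite zeta_op mulr_algl scalerA.
by move=> y; rewrite mulr_algl mulr_algr.
Qed.

Lemma zeta0 j : zeta 0 j = 0.
Proof. by rewrite -(scale0r (0 : A)) zetaZ mul0r. Qed.

Lemma zetaN z j : zeta (- z) j = - zeta z j.
Proof. by rewrite -scaleN1r zetaZ mulN1r. Qed.

Lemma zeta_sum (J : Type) (s : seq J) (P : pred J) (E : J -> A) j :
  zeta (\sum_(i <- s | P i) E i) j = \sum_(i <- s | P i) zeta (E i) j.
Proof.
by apply: (big_morph (fun z => zeta z j)) => [x y|]; [exact: zetaD | exact: zeta0].
Qed.

Lemma zetaM z w l : zeta (z * w) l =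
  \sum_i \sum_j zeta z i * (zeta w j * zeta (b i * b j) l).
Proof.
rewrite {1}(zeta_span z) {1}(zeta_span w) mulr_suml zeta_sum; apply: eq_bigr => i _.
rewrite mulr_sumr zeta_sum; apply: eq_bigr => j _.
by rewrite -scalerAl -scalerAr !zetaZ.
Qed.

Definition lat (X : {pred F}) : {pred A} := fun z => [forall j, zeta z j \in X].

Lemma latP (X : {pred F}) z : reflect (forall j, zeta z j \in X) (z \in lat X).
Proof. exact: forallP. Qed.

Lemma algebraic_elt z : exists2 f : {poly F}, f != 0 & horner_alg z f = 0.
Proof.
pose C := \matrix_(i < d.+1, j < d) zeta (z ^+ i) j.
have : kermx C != 0.
  by rewrite -mxrank_eq0 mxrank_ker -lt0n subn_gt0 (leq_ltn_trans (rank_leq_col C)).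
case/rowV0Pn=> w /sub_kermxP wC w0; pose f := \poly_(i < d.+1) w 0 (inord i).
have fE (i : 'I_d.+1) : f`_i = w 0 i by rewrite coef_poly ltn_ord inord_val.
exists f.
  apply: contraNneq w0 => f0; apply/eqP/rowP => i.
  by rewrite -fE f0 coef0 mxE.
have -> : horner_alg z f = \sum_(i < d.+1) w 0 i *: z ^+ i.
  rewrite /f poly_def raddf_sum; apply: eq_bigr => i _ /=.
  by rewrite inord_val linearZ /= rmorphXn /= horner_algX mulr_algl.
rewrite [LHS]zeta_span big1 // => j _; rewrite zeta_sum.
have := congr1 (fun M : 'rV_d => M 0 j) wC; rewrite !mxE => E.
rewrite (eq_bigr (fun i => w 0 i * C i j)) ?E ?scale0r // => i _.
by rewrite zetaZ mxE.
Qed.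

Lemma invertible_shift z (f : {poly F}) c : horner_alg z f = 0 -> f.[c] != 0 ->
  exists y, (z - c%:A) * y = 1 /\ y * (z - c%:A) = 1.
Proof.
move=> fz fc; have : root (f - f.[c]%:P) c.
  by rewrite /root hornerD hornerN hornerC subrr.
case/factor_theorem=> q Eq.
have Ez : horner_alg z ('X - c%:P) = z - c%:A.
  by rewrite rmorphB /= horner_algX horner_algC.
have E : horner_alg z q * (z - c%:A) = - f.[c]%:A.
  by rewrite -Ez -rmorphM -Eq rmorphB /= fz horner_algC sub0r.
have E' : (z - c%:A) * horner_alg z q = - f.[c]%:A.
  by rewrite -Ez -rmorphM mulrC -Eq rmorphB /= fz horner_algC sub0r.
exists (- f.[c]^-1 *: horner_alg z q).
by rewrite -scalerAr -scalerAl E E' scalerN scaleNr opprK scalerA mulVf // scale1r.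
Qed.

Variables (R O : subringClosed F) (I : {pred F}) (k : finFieldType) (psi : F -> k).
Hypotheses (OI : proper_ideal O I) (RO : {subset R <= O}) (psiH : hom_on R psi).
Hypothesis psiI : forall r, r \in R -> (psi r == 0) = (r \in I).
Hypothesis valO : forall x : F, x \notin O -> x^-1 \in I.
Hypothesis unitO : forall x : F, x \in O -> x \notin I -> x^-1 \in O.
Hypothesis Rb : forall i j l, zeta (b i * b j) l \in R.
Hypothesis R1 : forall j, zeta 1 j \in R.
Hypothesis RL : forall i p, p \in L i -> p.1 \in lat R /\ p.2 \in lat R.
Variable pi : F.
Hypotheses (Ipi : pi \in I) (pi0 : pi != 0).

Let IO : {subset I <= O} := ideal_sub OI.

Lemma latB (X : subringClosed F) : {in lat X &, forall z w, z - w \in lat X}.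
Proof.
move=> z w /latP Xz /latP Xw; apply/latP => j.
by rewrite zetaD zetaN rpredB.
Qed.

Lemma latM (X : subringClosed F) : {subset R <= X} ->
  {in lat X &, forall z w, z * w \in lat X}.
Proof.
move=> RX z w /latP Xz /latP Xw; apply/latP => l; rewrite zetaM.
by rewrite rpred_sum // => i _; rewrite rpred_sum // => j _; rewrite !rpredM // RX.
Qed.

Lemma lat1 (X : subringClosed F) : {subset R <= X} -> 1 \in lat X.
Proof. by move=> RX; apply/latP => j; apply: RX. Qed.

Fact latR_subring : subring_closed (lat R).
Proof. by split; [exact: lat1 | exact: latB | exact: latM]. Qed.

Fact latO_subring : subring_closed (lat O).
Proof. by split; [exact: lat1 | exact: latB | exact: latM]. Qed.

Definition LR : subringClosed A :=
  HB.pack (lat R) (GRing.isSubringClosed.Build A (lat R) latR_subring).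

Definition LO : subringClosed A :=
  HB.pack (lat O) (GRing.isSubringClosed.Build A (lat O) latO_subring).

Lemma LR_LO : {subset LR <= LO}.
Proof. by move=> z /latP Rz; apply/latP => j; apply: RO. Qed.

Lemma b_LR i : b i \in LR.
Proof. by apply/latP => j; rewrite zeta_b; case: (i == j); rewrite ?rpred1 ?rpred0. Qed.

Lemma latI0 : 0 \in lat I.
Proof. by apply/latP => j; rewrite zeta0 (ideal0 OI). Qed.

Lemma latID : {in lat I &, forall z w, z + w \in lat I}.
Proof.
by move=> z w /latP Xz /latP Xw; apply/latP => j; rewrite zetaD (idealD OI).
Qed.

Lemma latIN : {in lat I, forall z, - z \in lat I}.
Proof. by move=> z /latP Xz; apply/latP => j; rewrite zetaN (idealN OI). Qed.

Lemma latIB : {in lat I &, forall z w, z - w \in lat I}.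
Proof. by move=> z w Iz Iw; rewrite latID // latIN. Qed.

Lemma latI_LO : {subset lat I <= LO}.
Proof. by move=> z /latP Iz; apply/latP => j; apply: IO. Qed.

Lemma latIMl : {in LO & lat I, forall z w, z * w \in lat I}.
Proof.
move=> z w /latP Oz /latP Iw; apply/latP => l; rewrite zetaM.
apply: (ideal_sum OI) => i _; apply: (ideal_sum OI) => j _.
by rewrite mulrA mulrC (idealM OI) ?RO // (idealM OI).
Qed.

Lemma latIMr : {in lat I & LO, forall z w, z * w \in lat I}.
Proof.
move=> z w /latP Iz /latP Ow; apply/latP => l; rewrite zetaM.
apply: (ideal_sum OI) => i _; apply: (ideal_sum OI) => j _.
by rewrite mulrC (idealM OI) // rpredM // RO.
Qed.

Lemma latIZ : {in O & lat I, forall c z, c *: z \in lat I}.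
Proof. by move=> c z Oc /latP Iz; apply/latP => j; rewrite zetaZ (idealM OI). Qed.

Lemma latIZO : {in I & LO, forall c z, c *: z \in lat I}.
Proof. by move=> c z Ic /latP Oz; apply/latP => j; rewrite zetaZ mulrC (idealM OI). Qed.

Lemma LRZ : {in R & LR, forall c z, c *: z \in LR}.
Proof. by move=> c z Rc /latP Rz; apply/latP => j; rewrite zetaZ rpredM. Qed.

Lemma latI_unscale c z : c \notin O -> c *: z \in lat I -> z \in lat I.
Proof.
move=> Oc Icz; have c0 : c != 0 by apply: contraNneq Oc => ->; rewrite rpred0.
by rewrite -[z](scalerK c0) latIZ // IO // valO.
Qed.

Lemma latI_cancel c z : c \notin I -> c *: z \in lat I -> z \in lat I.
Proof.
move=> Ic; have [Oc Icz|Oc] := boolP (c \in O); last exact: latI_unscale.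
have c0 : c != 0 by apply: contraNneq Ic => ->; rewrite (ideal0 OI).
by rewrite -[z](scalerK c0) latIZ // unitO.
Qed.

(** The right regular representation in the basis [b], reduced entrywise. It realises the quotient
    of the [R]-lattice inside a matrix ring, without constructing a quotient ring. *)
Definition Phi z : 'M[k]_d := \matrix_(i, j) psi (zeta (b i * z) j).

Lemma Phi_subE z i j : z \in LR -> zeta (b i * z) j \in R.
Proof. by move=> Rz; have /latP/(_ j) : b i * z \in LR by rewrite rpredM // b_LR. Qed.

(** The representation is faithful modulo [I] because 1 lies in the lattice: [z = 1 * z] is a
    combination of the products [b i * z] with coefficients in [R]. *)
Lemma Phi0P z : z \in LR -> (Phi z == 0) = (z \in lat I).
Proof.
move=> Rz; apply/eqP/idP => [E|Iz].
  apply/latP => j; rewrite -[z]mul1r (zeta_span 1) mulr_suml zeta_sum.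
  apply: (ideal_sum OI) => i _; rewrite -scalerAl zetaZ (idealM OI) // ?RO //.
  rewrite -psiI ?Phi_subE //; have := congr1 (fun M : 'M_d => M i j) E.
  by rewrite !mxE => ->.
apply/matrixP => i j; rewrite !mxE; apply/eqP; rewrite psiI ?Phi_subE //.
by have /latP/(_ j) : b i * z \in lat I by rewrite latIMl // LR_LO // b_LR.
Qed.

Lemma PhiB : {in LR &, {morph Phi : z w / z - w}}.
Proof.
move=> z w Rz Rw; apply/matrixP => i j; rewrite !mxE mulrBr zetaD zetaN.
by rewrite (hom_onB psiH) ?Phi_subE.
Qed.

Lemma PhiD : {in LR &, {morph Phi : z w / z + w}}.
Proof.
move=> z w Rz Rw; apply/matrixP => i j; rewrite !mxE mulrDr zetaD.
by have [_ psiD _] := psiH; rewrite psiD ?Phi_subE.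
Qed.

Lemma PhiM : {in LR &, {morph Phi : z w / z * w}}.
Proof.
move=> z w Rz Rw; apply/matrixP => i l; rewrite !mxE mulrA (zeta_span (b i * z)).
rewrite mulr_suml zeta_sum (hom_on_sum psiH).
  apply: eq_bigr => j _; rewrite !mxE -scalerAl zetaZ.
  by have [_ _ psiM] := psiH; rewrite psiM ?Phi_subE.
by move=> j _; rewrite -scalerAl zetaZ rpredM ?Phi_subE.
Qed.

Lemma Phi_scalar c : c \in R -> Phi c%:A = (psi c)%:M.
Proof.
move=> Rc; apply/matrixP => i j; rewrite !mxE mulr_algr zetaZ zeta_b.
case: (i == j); first by rewrite mulr1 mulr1n.
by rewrite mulr0 mulr0n (hom_on0 psiH).
Qed.

Lemma Phi1 : Phi 1 = 1.
Proof. by rewrite -[1]scale1r Phi_scalar ?rpred1 //; have [-> _ _] := psiH. Qed.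

Lemma PhiZ c z : c \in R -> z \in LR -> Phi (c *: z) = psi c *: Phi z.
Proof.
move=> Rc Rz; apply/matrixP => i j; rewrite !mxE -scalerAr zetaZ.
by have [_ _ psiM] := psiH; rewrite psiM ?Phi_subE.
Qed.

Definition resB : {pred 'M[k]_d} := fun beta => `[< exists2 z, z \in LR & beta = Phi z >].

Lemma resBP beta : reflect (exists2 z, z \in LR & beta = Phi z) (beta \in resB).
Proof. exact: asboolP. Qed.

Lemma Phi_resB z : z \in LR -> Phi z \in resB.
Proof. by move=> Rz; apply/resBP; exists z. Qed.

Fact resB_subring : subring_closed resB.
Proof.
split=> [|_ _ /resBP [z Rz ->] /resBP [w Rw ->]|_ _ /resBP [z Rz ->] /resBP [w Rw ->]].
- by rewrite -Phi1 Phi_resB // rpred1.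
- by rewrite -PhiB // Phi_resB // rpredB.
- by rewrite -PhiM // Phi_resB // rpredM.
Qed.

Definition residue_ring : subringClosed 'M[k]_d :=
  HB.pack resB (GRing.isSubringClosed.Build 'M[k]_d resB resB_subring).

Definition Lk (i : 'I_d) := [seq (Phi p.1, Phi p.2) | p <- L i].

Lemma Lk_B i p : p \in Lk i -> p.1 \in residue_ring /\ p.2 \in residue_ring.
Proof. by case/mapP=> q /RL [Rq1 Rq2] ->; split; apply: Phi_resB. Qed.

(** The Artin-Whaples operators have their coefficients in the lattice and so descend to the residue
    ring, where they again yield coordinates as scalars. *)
Lemma mulop_Lk i z : z \in LR -> mulop (Lk i) (Phi z) = (psi (zeta z i))%:M.
Proof.
move=> Rz; have Rzi : zeta z i \in R by move/latP: Rz; apply.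
rewrite -Phi_scalar // -zeta_op /mulop big_map.
have : {subset L i <= L i} by [].
elim: {1 3 4}(L i) => [|p s IHs] sub.
  by rewrite !big_nil; apply/esym/eqP; rewrite Phi0P ?rpred0 ?latI0.
have [Rp1 Rp2] := RL (sub p (mem_head _ _)).
have sub' : {subset s <= L i} by move=> q qs; apply: sub; rewrite inE qs orbT.
have Rs : \sum_(q <- s) q.1 * z * q.2 \in LR.
  rewrite big_seq rpred_sum // => q /sub' /RL [Rq1 Rq2].
  by rewrite rpredM ?rpredM.
have Rpz : p.1 * z \in LR by rewrite rpredM.
rewrite !big_cons PhiD ?rpredM // IHs // !PhiM //.
Qed.

Lemma Lk_scalar i beta : beta \in residue_ring -> exists c : k, mulop (Lk i) beta = c%:M.
Proof. by case/resBP=> z Rz ->; exists (psi (zeta z i)); apply: mulop_Lk. Qed.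

Lemma Lk_nondeg beta : beta \in residue_ring -> beta != 0 -> exists i, mulop (Lk i) beta != 0.
Proof.
case/resBP=> z Rz ->; rewrite Phi0P // => /forallPn [i Iz]; exists i.
rewrite mulop_Lk //; move: Iz; rewrite -psiI; last by move/latP: Rz; apply.
apply: contraNneq => E; have := congr1 (fun M : 'M_d => M i i) E.
by rewrite !mxE eqxx mulr1n => ->.
Qed.

(** * Invertible lifts and their inverses *)

Lemma pi_expS_I n : pi ^+ n.+1 \in I.
Proof.
elim: n => [|n IHn]; first by rewrite expr1.
by rewrite exprS (idealM OI) // IO.
Qed.

Lemma pi_exp_inj : injective (fun n => pi ^+ n).
Proof.
have I1 : 1 \notin I by case: OI.
have lt_neq i j : (i < j)%N -> pi ^+ i <> pi ^+ j.
  move=> lt_ij /eqP; rewrite -(subnKC (ltnW lt_ij)) exprD -{1}[pi ^+ i]mulr1.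
  rewrite (inj_eq (mulfI (expf_neq0 i pi0))) => /eqP e; move/negP: I1; apply.
  by rewrite e -(prednK (_ : 0 < j - i)%N) ?subn_gt0 // pi_expS_I.
move=> i j e; case: (ltngtP i j) => // lt_ij; first by case: (lt_neq _ _ lt_ij).
by case: (lt_neq _ _ lt_ij).
Qed.

(** Even a [z] whose reduction is singular is congruent to a unit: among [size f] distinct elements
    [- pi ^+ i.+1] of [I], one is not a root of the polynomial [f] annihilating [z], and subtracting
    it makes [z] invertible. *)
Lemma unit_lift z : exists x x', [/\ x * x' = 1, x' * x = 1 & x - z \in lat I].
Proof.
have [f f0 fz] := algebraic_elt z.
pose S := [seq - pi ^+ i.+1 | i <- iota 0 (size f)].
have uS : uniq S.
  by rewrite map_inj_uniq ?iota_uniq // => i j /oppr_inj /pi_exp_inj [].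
have [c Sc fc] : exists2 c, c \in S & f.[c] != 0.
  apply: contrapT => no; have rootS : all (root f) S.
    apply/allP => c Sc; rewrite /root; apply: contrapT => /negP h.
    by apply: no; exists c.
  by have := max_poly_roots f0 rootS uS; rewrite size_map size_iota ltnn.
have [x' [xx' x'x]] := invertible_shift fz fc.
exists (z - c%:A), x'; split=> //; case/mapP: Sc => i _ ->.
by rewrite addrAC subrr add0r -scaleNr opprK latIZO ?pi_expS_I // rpred1.
Qed.

Lemma valuation_max (f : 'I_d -> F) (s : seq 'I_d) :
  (exists2 i, i \in s & f i != 0) ->
  exists j, f j != 0 /\ forall i, i \in s -> f i / f j \in O.
Proof.
elim: s => [[]//|i0 s IHs [i1 si1 fi1]].
have [/IHs [j [fj0 fj]]|none] := pselect (exists2 i, i \in s & f i != 0).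
  have [Oi0|Oi0] := boolP (f i0 / f j \in O).
    by exists j; split=> // i; rewrite inE => /predU1P [->|/fj].
  have fi0 : f i0 != 0 by apply: contraNneq Oi0 => ->; rewrite mul0r rpred0.
  exists i0; split=> // i; rewrite inE => /predU1P [->|/fj fi].
    by rewrite divff // rpred1.
  have -> : f i / f i0 = (f i / f j) * (f i0 / f j)^-1 by field; rewrite fi0 fj0.
  by rewrite rpredM // IO // valO.
have z i : i \in s -> f i = 0.
  by move=> si; apply/eqP; apply: contrapT => /negP h; apply: none; exists i.
have fi0 : f i0 != 0.
  by move: si1; rewrite inE => /predU1P [<-//|/z e]; rewrite e eqxx in fi1.
exists i0; split=> // i; rewrite inE => /predU1P [->|/z ->].
  by rewrite divff // rpred1.
by rewrite mul0r rpred0.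
Qed.

(** Divisibility is total in a valuation ring, so one coordinate of [x] divides all others; dividing
    by it makes that coordinate 1. *)
Lemma primitive_scaling x : x != 0 ->
  exists alpha, [/\ alpha != 0, alpha *: x \in LO & alpha *: x \notin lat I].
Proof.
move=> x0; have [|j [zj0 zj]] := @valuation_max (zeta x) (enum 'I_d).
  apply: contrapT => no; move/negP: x0; apply; rewrite (zeta_span x) big1 // => i _.
  suff -> : zeta x i = 0 by rewrite scale0r.
  by apply/eqP; apply: contrapT => /negP h; apply: no; exists i; rewrite ?mem_enum.
exists (zeta x j)^-1; split; first by rewrite invr_eq0.
  by apply/latP => i; rewrite zetaZ mulrC zj ?mem_enum.
apply/negP => /latP /(_ j); rewrite zetaZ mulVf //.
by apply/negP; case: OI.
Qed.

(* Reduction up to scalars on both sides; the scalar [c] need not lift to [R]. *)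
Definition Red x (beta : 'M[k]_d) : Prop :=
  exists (alpha : F) (T : A) (c : k),
  [/\ alpha != 0, c != 0, T \in LR, Phi T = c *: beta & alpha *: x - T \in lat I].

Lemma RedM x y beta gamma : Red x beta -> Red y gamma -> Red (x * y) (beta * gamma).
Proof.
move=> [a1 [T1 [c1 [a10 c10 R1' E1 I1]]]] [a2 [T2 [c2 [a20 c20 R2 E2 I2]]]].
exists (a1 * a2), (T1 * T2), (c1 * c2); split; rewrite ?mulf_neq0 //.
- exact: rpredM.
- by rewrite PhiM // E1 E2 mulscaleL mulscaleR scalerA.
have -> : (a1 * a2) *: (x * y) - T1 * T2 = (a1 *: x - T1) * (a2 *: y) + T1 * (a2 *: y - T2).
  by rewrite mulrBl mulrBr -scalerAl -scalerAr scalerA addrA subrK.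
apply: latID; last by rewrite latIMl ?LR_LO.
apply: latIMr => //; rewrite -[a2 *: y](subrK T2).
by apply: rpredD; [apply: latI_LO | apply: LR_LO].
Qed.

Lemma RedZ x beta (c : k) : c != 0 -> Red x (c *: beta) -> Red x beta.
Proof.
move=> c0 [a [T [c' [a0 c'0 RT E IT]]]]; exists a, T, (c' * c).
by split; rewrite ?mulf_neq0 // E scalerA.
Qed.

Lemma RedN x beta : Red x (- beta) -> Red x beta.
Proof. by rewrite -scaleN1r; apply: RedZ; rewrite oppr_eq0 oner_eq0. Qed.

Lemma Red_lift x T : T \in LR -> x - T \in lat I -> Red x (Phi T).
Proof.
by move=> RT IT; exists 1, T, 1; rewrite !scale1r !oner_neq0; split.
Qed.

(** The factor [alpha] need not come from [R], so [Phi T] is not visibly scalar; but [T] commutes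
    with the lattice modulo [I], and the centre of the residue ring is scalar. *)
Lemma Red1_scalar beta : Red 1 beta -> exists c : k, beta = c%:M.
Proof.
move=> [a [T [c [a0 c0 RT E IT]]]].
have [|w Bw|c' Ec'] := @finite_center k d d residue_ring Lk Lk_B Lk_scalar Lk_nondeg (Phi T).
- exact: Phi_resB.
- case/resBP: Bw => W RW ->; apply/eqP; rewrite -subr_eq0 -!PhiM // -PhiB ?rpredM //.
  rewrite Phi0P ?rpredB ?rpredM //.
  have -> : T * W - W * T = W * (a *: 1 - T) - (a *: 1 - T) * W.
    by rewrite mulrBr mulrBl mulr_algl mulr_algr opprB [RHS]addrC addrA subrK.
  by apply: latIB; [apply: latIMl | apply: latIMr] => //; apply: LR_LO.
exists (c^-1 * c'); rewrite -scale_scalar_mx -Ec' E scalerA mulVf // scale1r //.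
Qed.

(** Nothing places [x'] in the lattice beforehand. A primitive multiple [a *: x'] does lie in it,
    and [(W * x - 1) * (a *: x')] equals [a *: (W - x')]; it remains to cancel [a]. *)
Lemma lift_unit T W : T \in LR -> W \in LR -> Phi T * Phi W = 1 -> Phi W * Phi T = 1 ->
  exists x x', [/\ x * x' = 1, x' * x = 1, Red x (Phi T) & Red x' (Phi W)].
Proof.
move=> RT RW TW WT; have [x [x' [xx' x'x IxT]]] := unit_lift T.
exists x, x'; split=> //; first exact: Red_lift.
have Wx1 : W * x - 1 \in lat I.
  have -> : W * x - 1 = W * (x - T) + (W * T - 1) by rewrite mulrBr addrA subrK.
  rewrite latID // ?latIMl ?LR_LO // -Phi0P ?rpredB ?rpredM ?rpred1 //.
  by rewrite PhiB ?rpredM ?rpred1 // PhiM // Phi1 WT subrr.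
have x'0 : x' != 0.
  by apply/eqP => x'0; have /eqP := xx'; rewrite x'0 mulr0 eq_sym oner_eq0.
have [a [a0 Oa Ia]] := primitive_scaling x'0.
have Iaw : a *: (W - x') \in lat I.
  have -> : a *: (W - x') = (W * x - 1) * (a *: x').
    by rewrite mulrBl mul1r -scalerAr -mulrA xx' mulr1 scalerBr.
  exact: latIMr.
(* Otherwise [a *: W], and with it [a *: x'], would vanish modulo [I]. *)
have aI : a \notin I.
  apply: contra Ia => aI; have -> : a *: x' = a *: W - a *: (W - x').
    by rewrite scalerBr opprB addrC subrK.
  by rewrite latIB // latIZO ?LR_LO.
by apply: Red_lift => //; rewrite -opprB latIN // (latI_cancel aI).
Qed.

Lemma psi_scalar T W (c : k) : T \in LR -> W \in LR -> Phi T = c *: Phi W -> Phi W != 0 ->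
  exists2 r, r \in R & psi r = c.
Proof.
move=> RT RW E W0; have [|i] := @Lk_nondeg (Phi W) _ W0; first exact: Phi_resB.
have zR z : z \in LR -> zeta z i \in R by move/latP.
have [_ _ psiM] := psiH.
rewrite mulop_Lk // => zW; have zW0 : psi (zeta W i) != 0.
  by apply: contraNneq zW => ->; rewrite -[0%:M]/(scalar_mx 0) raddf0.
have Ec : psi (zeta T i) = c * psi (zeta W i).
  have : mulop (Lk i) (Phi T) = c *: mulop (Lk i) (Phi W).
    rewrite E /mulop scaler_sumr; apply: eq_bigr => p _.
    by rewrite mulscaleR mulscaleL.
  rewrite !mulop_Lk // scale_scalar_mx => /matrixP /(_ i i).
  by rewrite !mxE eqxx !mulr1n.
(* In [k] the inverse of a nonzero element is its power of exponent [#|k| - 2], so the image of [R]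
   is closed under quotients. *)
exists (zeta T i * zeta W i ^+ (#|k| - 2)); first by rewrite rpredM ?rpredX ?zR.
rewrite psiM ?rpredX ?zR // (hom_onX psiH) ?zR // Ec -mulrA -exprS.
have -> : ((#|k| - 2).+1 = #|k|.-1)%N.
  by case: #|k| (finNzRing_gt1 k) => [|[|m]] // _; rewrite !subSS subn0.
have /eqP := expf_card (psi (zeta W i)).
rewrite -{1}(prednK (ltnW (finNzRing_gt1 k))) exprS -subr_eq0 -[X in _ - X]mulr1.
rewrite -mulrBr mulf_eq0 (negbTE zW0) subr_eq0 => /eqP ->.
by rewrite mulr1.
Qed.

(* An invertible lift [x] of [1 - e] cannot be invertible modulo [I], and the reduction of a
   primitive multiple of its inverse is annihilated by [1 - e] on both sides. *)
Lemma lift_idempotent W : W \in LR -> Phi W * Phi W = Phi W -> Phi W != 0 ->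
  (forall beta, beta \in residue_ring -> exists c : k, Phi W * beta * Phi W = c *: Phi W) ->
  exists x x', [/\ x * x' = 1, x' * x = 1, Red x (1 - Phi W) & Red x' (Phi W)].
Proof.
move=> RW WW W0 Wscal; have RT : 1 - W \in LR by rewrite rpredB ?rpred1.
have [x [x' [xx' x'x IxT]]] := unit_lift (1 - W).
exists x, x'; split=> //.
  by rewrite -Phi1 -PhiB ?rpred1 //; apply: Red_lift.
have x'0 : x' != 0.
  by apply/eqP => x'0; have /eqP := xx'; rewrite x'0 mulr0 eq_sym oner_eq0.
have [a [a0 Oa Ia]] := primitive_scaling x'0; set Y := a *: x' in Oa Ia *.
have xY : x * Y = a%:A by rewrite /Y -scalerAr xx'.
have Yx : Y * x = a%:A by rewrite /Y -scalerAl x'x.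
have IW : W * (1 - W) \in lat I.
  by rewrite -Phi0P ?rpredM // PhiM // PhiB ?rpred1 // Phi1 mulrBr mulr1 WW subrr.
have nIW : W \notin lat I by rewrite -Phi0P.
have IWx : W * x \in lat I.
  rewrite -[x](subrK (1 - W)) mulrDr; apply: latID => //.
  by rewrite latIMl ?LR_LO.
have aI : a \in I.
  apply: contraNT nIW => aI; apply: (latI_cancel aI).
  have -> : a *: W = W * x * Y by rewrite -mulrA xY mulr_algr.
  exact: latIMr.
have IaA : a%:A \in lat I by rewrite latIZO ?rpred1.
have IYl : Y - W * Y \in lat I.
  have -> : Y - W * Y = a%:A - (x - (1 - W)) * Y.
    by rewrite -xY mulrBl opprB [RHS]addrC subrK mulrBl mul1r.
  by rewrite latIB // latIMr.
have IYr : Y - Y * W \in lat I.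
  have -> : Y - Y * W = a%:A - Y * (x - (1 - W)).
    by rewrite -Yx mulrBr opprB [RHS]addrC subrK mulrBr mulr1.
  by rewrite latIB // latIMl.
have IYWYW : Y - W * Y * W \in lat I.
  have -> : Y - W * Y * W = (Y - W * Y) + W * (Y - Y * W).
    by rewrite mulrBr addrA subrK mulrA.
  by rewrite latID // latIMl ?LR_LO.
(* By rank one, [W b_i W] is congruent to [r_i W] with [r_i] in [R]. By linearity [W Y W] is then
   congruent to a multiple of [W] with a coefficient [t] in [O], although the coordinates of [Y] may
   lie outside [R]. *)
have WbW i : {r | r \in R & W * b i * W - r *: W \in lat I}.
  apply: cid2; have RWb : W * b i * W \in LR by rewrite !rpredM ?b_LR.
  have [|c Ec] := Wscal (Phi (b i)); first by rewrite Phi_resB ?b_LR.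
  have EWb : Phi (W * b i * W) = c *: Phi W by rewrite !PhiM ?rpredM ?b_LR.
  have [r Rr Er] := psi_scalar RWb RW EWb W0; exists r => //.
  by rewrite -Phi0P ?rpredB ?LRZ // PhiB ?LRZ // PhiZ // EWb Er subrr.
pose r i := s2val (WbW i).
have Rr i : r i \in R by rewrite /r; case: (WbW i).
have Ir i : W * b i * W - r i *: W \in lat I by rewrite /r; case: (WbW i).
pose t := \sum_i zeta Y i * r i.
have Ot : t \in O.
  rewrite rpred_sum // => i _; apply: rpredM; [by move/latP: Oa | exact: RO].
have IYt : Y - t *: W \in lat I.
  have -> : Y - t *: W = (Y - W * Y * W) + \sum_i zeta Y i *: (W * b i * W - r i *: W).
    have -> : \sum_i zeta Y i *: (W * b i * W - r i *: W) = W * Y * W - t *: W.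
      rewrite {2}(zeta_span Y) mulr_sumr mulr_suml /t scaler_suml -sumrB.
      by apply: eq_bigr => i _; rewrite -scalerAr -scalerAl scalerBr scalerA.
    by rewrite addrA subrK.
  rewrite latID //; apply: (big_ind (fun z => z \in lat I)) => [||i _].
  - exact: latI0.
  - exact: latID.
  - by rewrite latIZ //; move/latP: Oa; apply.
have tI : t \notin I.
  apply: contra Ia => tI; rewrite -[Y](subrK (t *: W)) latID // latIZO ?LR_LO //.
have t0 : t != 0 by apply: contraNneq tI => ->; rewrite (ideal0 OI).
exists (t^-1 * a), W, 1; rewrite scale1r oner_neq0 mulf_neq0 ?invr_eq0 //; split=> //.
apply: (latI_cancel tI).
by rewrite scalerBr scalerA mulrA mulfV // mul1r.
Qed.

(* Conjugating a lift of the unipotent [1 + n] by such an [x] scales [n] up until it dominates. *)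
Lemma lift_nilpotent W N : W \in LR -> N \in LR -> Phi W * Phi W = Phi W -> Phi W != 0 ->
  (forall beta, beta \in residue_ring -> exists c : k, Phi W * beta * Phi W = c *: Phi W) ->
  Phi W * Phi N = Phi N -> Phi N * Phi W = 0 ->
  exists y y', [/\ y * y' = 1, y' * y = 1, Red y (Phi N) & Red y' (Phi N)].
Proof.
move=> RW RN WW W0 Wscal WN NW.
have [x [x' [xx' x'x rx rx']]] := lift_idempotent RW WW W0 Wscal.
have NN : Phi N * Phi N = 0 by rewrite -{2}WN mulrA NW mul0r.
have R1N : 1 + N \in LR by rewrite rpredD ?rpred1.
have R1N' : 1 - N \in LR by rewrite rpredB ?rpred1.
have E1 : Phi (1 + N) = 1 + Phi N by rewrite PhiD ?rpred1 // Phi1.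
have E2 : Phi (1 - N) = 1 - Phi N by rewrite PhiB ?rpred1 // Phi1.
have [||q [q' [qq' q'q rq rq']]] := lift_unit R1N R1N'.
- by rewrite E1 E2 mulrDl mul1r mulrBr mulr1 NN subr0 subrK.
- by rewrite E1 E2 mulrDr mulr1 mulrBl mul1r NN subr0 subrK.
exists (x' * q * x), (x' * q' * x); split.
- by rewrite -!mulrA (mulrA x) xx' mul1r (mulrA q) qq' mul1r.
- by rewrite -!mulrA (mulrA x) xx' mul1r (mulrA q') q'q mul1r.
(* For [e = Phi W] and [n = Phi N], [e (1 + n) (1 - e) = n]; the inverse gives
   [e (1 - n) (1 - e) = - n]. *)
- have := RedM (RedM rx' rq) rx; rewrite E1 [Phi W * (1 + _)]mulrDr mulr1 WN mulrBr mulr1.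
  by rewrite mulrDl WW NW addr0 addrC addKr.
- have := RedM (RedM rx' rq') rx; rewrite E2 [Phi W * (1 - _)]mulrBr mulr1 WN mulrBr mulr1.
  by rewrite mulrBl WW NW subr0 addrC addKr; apply: RedN.
Qed.

(** * The free pair in the lattice *)

Variables (a a' g : A) (S : seq F) (l : seq (option nat)).
Hypotheses (Ra : a \in LR) (Ra' : a' \in LR) (Rg : g \in LR).
Hypotheses (aa' : a * a' = 1) (a'a : a' * a = 1) (agI : a * g - g * a \notin lat I).
Hypotheses (SR : {subset S <= R}) (uS : uniq [seq psi s | s <- S]) (szS : (10 <= size S)%N).

Lemma lattice_free_pair : exists (y : bool -> A * A) (j : bool -> nat),
  (forall i, inverse_pair (y i)) /\
  forall v, v != [::] -> reduced_word v ->
  word_eval (fun i => (a' ^+ j i * (run a a' (None :: l) (y i)).1 * a ^+ j i,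
                       a' ^+ j i * (run a a' (None :: l) (y i)).2 * a ^+ j i)) v <> 1.
Proof.
pose al := Phi a; pose al' := Phi a'.
have Bal : al \in residue_ring by apply: Phi_resB.
have Bal' : al' \in residue_ring by apply: Phi_resB.
have alal' : al * al' = 1 by rewrite -PhiM // aa' Phi1.
have al'al : al' * al = 1 by rewrite -PhiM // a'a Phi1.
have algal : al * Phi g != Phi g * al.
  rewrite -subr_eq0 -!PhiM // -PhiB ?rpredM // Phi0P ?rpredB ?rpredM //.
have Bscalar s : s \in R -> (psi s)%:M \in residue_ring.
  by move=> Rs; rewrite -Phi_scalar // Phi_resB // LRZ ?rpred1.
have [t [St t0 t1]] : exists t, [/\ t \in S, psi t != 0 & psi t != 1].
  apply: contrapT => no; have sub : {subset [seq psi s | s <- S] <= [:: 0; 1]}.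
    move=> _ /mapP [s Ss ->]; rewrite !inE; apply: contrapT => /negP.
    by rewrite negb_or => /andP [s0 s1]; apply: no; exists s.
  have := uniq_leq_size uS sub; rewrite size_map => /(leq_trans szS) //.
have [e [n [[Be Bn ee e0 en] ne escal nscal [nan na'n]]]] :=
  moving_nilpotent Lk_B Lk_scalar Lk_nondeg Bal Bal' (Phi_resB Rg) alal' algal
    (Bscalar _ (SR St)) t0 t1.
have nn : n * n = 0 by rewrite -{2}en mulrA ne mul0r.
have n0 : n != 0 by apply: contraNneq nan => ->; rewrite mulr0.
have szS' : (10 <= size [seq psi s | s <- S])%N by rewrite size_map.
have [_ /mapP [s Ss ->] [c1 c2 c3]] :=
  ping_pong_conjugator Bal Bal' Bn nn nscal nan na'n uS szS'.
pose cc := al * n * al'.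
pose q (i : bool) := if i then 1 + psi s *: cc else 1.
pose q' (i : bool) := if i then 1 - psi s *: cc else 1.
have Bcc : psi s *: cc \in residue_ring.
  by rewrite -mulscalarE rpredM ?Bscalar ?SR // !rpredM.
have Bq i : q i \in residue_ring by case: i; rewrite ?rpredD ?rpred1.
have Bq' i : q' i \in residue_ring by case: i; rewrite ?rpredB ?rpred1.
have cc0 : cc * cc = 0.
  by rewrite /cc !mulrA -[_ * al' * al]mulrA al'al mulr1 -[_ * n * n]mulrA nn mulr0 mul0r.
have q'q i : q' i * q i = 1.
  case: i; rewrite /q /q' ?mulr1 // mulrBl mul1r mulrDr mulr1.
  by rewrite mulscaleL mulscaleR cc0 !scaler0 addr0 addrK.
have qM i (x y : 'M[k]_d) : (q i * x * q' i) * (q i * y * q' i) = q i * (x * y) * q' i.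
  have -> : (q i * x * q' i) * (q i * y * q' i) = q i * x * (q' i * q i) * (y * q' i).
    by rewrite !mulrA.
  by rewrite q'q mulr1 !mulrA.
have R_id T : T \in LR -> Red T (Phi T).
  by move=> RT; apply: Red_lift => //; rewrite subrr latI0.
have R11 : Red 1 1 by rewrite -Phi1; apply: R_id; rewrite rpred1.
have qK i (x : 'M[k]_d) : q' i * (q i * x * q' i) * q i = x.
  have -> : q' i * (q i * x * q' i) * q i = (q' i * q i) * x * (q' i * q i).
    by rewrite !mulrA.
  by rewrite q'q mul1r mulr1.
have n_i0 i (x : 'M[k]_d) : x \in residue_ring -> n * (q' i * x * q i) * n != 0 ->
    exists2 c : k, c != 0 & (q i * n * q' i) * x * (q i * n * q' i) = c *: (q i * n * q' i).
  move=> Bx nx; have [|c Ec] := nscal (q' i * x * q i); first by rewrite !rpredM.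
  exists c; first by apply: contraNneq nx => c0; rewrite Ec c0 scale0r.
  have -> : (q i * n * q' i) * x * (q i * n * q' i) = q i * (n * (q' i * x * q i) * n) * q' i.
    by rewrite !mulrA.
  by rewrite Ec mulscaleR mulscaleL.
(* The conjugation by [q i] is carried out in the residue ring: preimages of the conjugates of [e]
   and [n] are chosen there and lifted for each [i] separately. *)
have lift_y (i : bool) : exists p : A * A,
    [/\ inverse_pair p, Red p.1 (q i * n * q' i) & Red p.2 (q i * n * q' i)].
  have /resBP [W RW EW] : q i * e * q' i \in residue_ring by rewrite !rpredM.
  have /resBP [N RN EN] : q i * n * q' i \in residue_ring by rewrite !rpredM.
  have [||beta Bbeta|||y [y' [yy' y'y ry ry']]] := @lift_nilpotent W N RW RN.
  - by rewrite -EW qM ee.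
  - by rewrite -EW; apply: contraNneq e0 => E; rewrite -(qK i e) E mulr0 mul0r.
  - have [|c Ec] := escal (q' i * beta * q i); first by rewrite !rpredM.
    exists c; rewrite -EW.
    have -> : q i * e * q' i * beta * (q i * e * q' i) = q i * (e * (q' i * beta * q i) * e) * q' i.
      by rewrite !mulrA.
    by rewrite Ec mulscaleR mulscaleL.
  - by rewrite -EW -EN qM en.
  - by rewrite -EW -EN qM ne mulr0 mul0r.
  by exists (y, y'); rewrite EN; split.
have [y yP] := choice lift_y.
have Ral := R_id _ Ra; have Ral' := R_id _ Ra'.
have run_y (i : bool) : exists j,
    Red (a' ^+ j * (run a a' (None :: l) (y i)).1 * a ^+ j) (al * (q i * n * q' i)) /\
    Red (a' ^+ j * (run a a' (None :: l) (y i)).2 * a ^+ j) ((q i * n * q' i) * al').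
  have [_ ry ry'] := yP i.
  have [c cn0 Ec] := n_i0 i al Bal (c1 i i); have [c' c'n0 Ec'] := n_i0 i al' Bal' (c2 i i).
  exact: (run_Red RedM RedZ Ral Ral' alal' al'al Ec Ec' cn0 c'n0 l R11 ry ry').
have [j jP] := choice run_y.
exists y, j; split=> [i|v v0 redv]; first by case: (yP i).
apply: (word_neq1 RedM RedZ Red1_scalar al'al q'q _ _ _ c1 c2 c3 ne n0 e0 v0 redv).
- by move=> i; have [] := jP i; rewrite !mulrA.
- by move=> i; have [] := jP i; rewrite !mulrA.
- move=> i i' x xal; apply: nscal.
  have Bx : x \in residue_ring.
    by move: xal; rewrite !inE => /or3P [] /eqP -> //; apply: rpred1.
  by rewrite !rpredM.
Qed.
End Lattice.

(** * Free pairs in central simple algebras *)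

(* "Not locally finite", in the form that yields nonzero elements in kernels of residue maps. *)
Definition no_finite_embedding (F : fieldType) : Prop :=
  exists l0 : seq F, forall R : subringClosed F, {subset l0 <= R} ->
  forall (k : finFieldType) (psi : F -> k), hom_on R psi ->
  exists2 r, r \in R & r != 0 /\ psi r = 0.

Lemma pred_card_gt0 (k : finFieldType) : (0 < #|k|.-1)%N.
Proof. by case: #|k| (finNzRing_gt1 k) => [|[]]. Qed.

Lemma expf_pred_card (k : finFieldType) (x : k) : x != 0 -> x ^+ #|k|.-1 = 1.
Proof.
move=> x0; apply: (mulfI x0); rewrite -exprS prednK ?expf_card ?mulr1 //.
exact: ltnW (finNzRing_gt1 k).
Qed.

Lemma kernel_proper_ideal (F : fieldType) (R : subringClosed F) (k : finFieldType) (psi : F -> k) :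
  hom_on R psi -> proper_ideal R (fun r => (r \in R) && (psi r == 0)).
Proof.
move=> psiH; have [psi1 _ psiM] := psiH; split.
- by move=> r /andP [].
- by apply/andP; rewrite rpred0 (hom_on0 psiH).
- by apply/negP => /andP [_]; rewrite psi1 oner_eq0.
- move=> x y /andP [Rx /eqP px] /andP [Ry /eqP py]; apply/andP.
  by rewrite rpredB // (hom_onB psiH) // px py subrr.
- move=> x y Rx /andP [Ry /eqP py]; apply/andP.
  by rewrite rpredM // psiM // py mulr0.
Qed.

(** The powers of a nonzero [r] with [psi r = 0] are distinct, since equality of two of them would
    make a positive power of [r] equal to 1. *)
Lemma exists_distinct (F : fieldType) m : no_finite_embedding F ->
  exists S : seq F, uniq S /\ size S = m.
Proof.
case=> l0 l0P; have [R [l0R resR]] := exists_residually_finite l0.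
have [|k [psi [psiH _]]] := resR 1 (rpred1 _); first exact: oner_neq0.
have [r Rr [r0 pr]] := l0P _ l0R _ _ psiH.
exists [seq r ^+ i | i <- iota 0 m]; rewrite size_map size_iota; split=> //.
have lt_neq i j : (i < j)%N -> r ^+ i <> r ^+ j.
  move=> lt_ij /eqP; rewrite -(subnKC (ltnW lt_ij)) exprD -{1}[r ^+ i]mulr1.
  rewrite (inj_eq (mulfI (expf_neq0 i r0))) => /eqP e.
  have := congr1 psi e; have [-> _ _] := psiH.
  rewrite (hom_onX psiH) // pr expr0n subn_eq0 leqNgt lt_ij /= => /eqP.
  by rewrite oner_eq0.
rewrite map_inj_uniq ?iota_uniq // => i j e.
case: (ltngtP i j) => // lt_ij; first by case: (lt_neq _ _ lt_ij).
by case: (lt_neq _ _ lt_ij).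
Qed.

Lemma algebra_free_pair (F : fieldType) (A : algType F) d (b : 'I_d -> A)
    (L : 'I_d -> seq (A * A)) (zeta : A -> 'I_d -> F)
    (zeta_span : forall z, z = \sum_j zeta z j *: b j)
    (zeta_op : forall z j, mulop (L j) z = (zeta z j)%:A)
    (zeta_b : forall i j, zeta (b i) j = (i == j)%:R)
    (a a' g : A) (l : seq (option nat)) :
  no_finite_embedding F -> a * a' = 1 -> a' * a = 1 -> a * g <> g * a ->
  exists (y : bool -> A * A) (j : bool -> nat),
  (forall i, inverse_pair (y i)) /\
  forall v, v != [::] -> reduced_word v ->
  word_eval (fun i => (a' ^+ j i * (run a a' (None :: l) (y i)).1 * a ^+ j i,
                       a' ^+ j i * (run a a' (None :: l) (y i)).2 * a ^+ j i)) v <> 1.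
Proof.
move=> nlf aa' a'a ag.
have [S [uS szS]] := exists_distinct 10 nlf; have [l0 l0P] := nlf.
pose co (z : A) := [seq zeta z j | j <- enum 'I_d].
have coP z j : zeta z j \in co z by apply: map_f; rewrite mem_enum.
(* The inverses of the differences are put into [R] so that [psi] stays injective on [S]; likewise
   the next list keeps the commutator of [a] and [g] nonzero modulo [I]. *)
pose dS := [seq (s - t)^-1 | s <- S, t <- S].
pose ci := [seq c^-1 | c <- co (a * g - g * a)].
pose cs := flatten [seq co z | z <- [:: 1; a; a'; g]].
pose cb := flatten [seq co (b i * b j) | i <- enum 'I_d, j <- enum 'I_d].
pose cL := flatten [seq co p.1 ++ co p.2 | p <- flatten [seq L i | i <- enum 'I_d]].
have [R [gensR resR]] := exists_residually_finite (flatten [:: l0; S; dS; ci; cs; cb; cL]).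
have [|k [psi [psiH _]]] := resR 1 (rpred1 _); first exact: oner_neq0.
have [psi1 _ psiM] := psiH.
have partR s : s \in [:: l0; S; dS; ci; cs; cb; cL] -> {subset s <= R}.
  by move=> ps x xs; apply: gensR; apply/flattenP; exists s.
have l0R : {subset l0 <= R} by apply: partR; rewrite !inE eqxx.
have SR : {subset S <= R} by apply: partR; rewrite !inE eqxx orbT.
have dR : {subset dS <= R} by apply: partR; rewrite !inE eqxx !orbT.
have ciR : {subset ci <= R} by apply: partR; rewrite !inE eqxx !orbT.
have csR : {subset cs <= R} by apply: partR; rewrite !inE eqxx !orbT.
have cbR : {subset cb <= R} by apply: partR; rewrite !inE eqxx !orbT.
have cLR : {subset cL <= R} by apply: partR; rewrite !inE eqxx !orbT.
have coR z : z \in [:: 1; a; a'; g] -> forall j, zeta z j \in R.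
  by move=> zs j; apply: csR; apply/flatten_mapP; exists z.
have Rb i j m : zeta (b i * b j) m \in R.
  apply: cbR; apply/flattenP; exists (co (b i * b j)) => //.
  by apply/allpairsP; exists (i, j); rewrite !mem_enum.
have RL i p : p \in L i -> p.1 \in lat zeta R /\ p.2 \in lat zeta R.
  move=> Lp; split; apply/latP => j; apply: cLR; apply/flatten_mapP; exists p.
  - by apply/flatten_mapP; exists i; rewrite ?mem_enum.
  - by rewrite mem_cat coP.
  - by apply/flatten_mapP; exists i; rewrite ?mem_enum.
  - by rewrite mem_cat coP orbT.
have [O [I [OI RO MI valO unitO]]] := exists_valuation_ring (kernel_proper_ideal psiH).
have I1 : 1 \notin I by case: OI.
have psiI r : r \in R -> (psi r == 0) = (r \in I).
  move=> Rr; apply/idP/idP => [pr|Ir]; first by apply: MI; apply/andP.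
  (* If [psi r] is nonzero, [1 - r ^+ #|k|.-1] is in the kernel, hence in [I]; so [r] in [I] would
     put 1 there. *)
  apply: contraNT I1 => pr.
  have IrX : r ^+ #|k|.-1 \in I.
    by rewrite -(prednK (pred_card_gt0 k)) exprSr (idealM OI) // rpredX // RO.
  rewrite -[1](subrK (r ^+ #|k|.-1)) (idealD OI) //; apply: MI; apply/andP.
  have RrX : r ^+ #|k|.-1 \in R by rewrite rpredX.
  split; first by rewrite rpredB ?rpred1.
  by rewrite (hom_onB psiH) ?rpred1 // (hom_onX psiH) // expf_pred_card // psi1 subrr.
have [pi Rpi [pi0 ppi]] := l0P _ l0R _ _ psiH.
have Ipi : pi \in I by rewrite -psiI // ppi.
have latR z : z \in [:: 1; a; a'; g] -> z \in lat zeta R.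
  by move=> zs; apply/latP => j; apply: coR.
have R1 j : zeta 1 j \in R by apply: coR; rewrite inE eqxx.
have agI : a * g - g * a \notin lat zeta I.
  apply/negP => /latP Iag; apply: ag; apply/eqP; rewrite -subr_eq0; apply/eqP.
  rewrite [LHS]zeta_span big1 // => j _.
  have [->|c0] := eqVneq (zeta (a * g - g * a) j) 0; first by rewrite scale0r.
  move/negP: I1; case; rewrite -(mulVf c0) (idealM OI) // RO // ciR //.
  by apply: map_f.
have uS' : uniq [seq psi s | s <- S].
  rewrite map_inj_in_uniq // => s t Ss St e; apply/eqP; rewrite -subr_eq0.
  apply: contraTT isT => st0; have Rst : (s - t)^-1 \in R.
    by apply: dR; apply/allpairsP; exists (s, t).
  have [Rs Rt] := (SR _ Ss, SR _ St); have Rd : s - t \in R by rewrite rpredB.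
  have := congr1 psi (mulVf st0); rewrite psiM // (hom_onB psiH) //.
  by rewrite e subrr mulr0 psi1 => /esym/eqP; rewrite oner_eq0.
apply: (@lattice_free_pair F A d b L zeta zeta_span zeta_op zeta_b R O I k psi OI RO psiH psiI
  valO unitO Rb R1 RL pi Ipi pi0 a a' g S l) => //; rewrite ?szS //.
- by apply: latR; rewrite !inE eqxx orbT.
- by apply: latR; rewrite !inE eqxx !orbT.
- by apply: latR; rewrite !inE eqxx !orbT.
Qed.

(** * Matrix rings over a division ring as algebras over its centre *)

Section Centre.
Variable K : unitRingType.

Definition centre_pred : {pred K} := fun x => `[< central x >].

Fact centre_divring : divring_closed centre_pred.
Proof.
split=> [|x y /asboolP xC /asboolP yC|x y /asboolP xC /asboolP yC]; apply/asboolP.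
- exact: central1.
- exact: centralB.
- by apply: centralM => //; apply: centralV.
Qed.

HB.instance Definition _ := GRing.isDivringClosed.Build K centre_pred centre_divring.

Definition centre := {x : K | x \in centre_pred}.

HB.instance Definition _ := SubChoice.on centre.
HB.instance Definition _ := [SubChoice_isSubUnitRing of centre by <:].

Lemma centreP (x : centre) : central (val x).
Proof. exact/asboolP/(valP x). Qed.

Fact centre_mulC : @commutative centre centre *%R.
Proof. by move=> x y; apply: val_inj; rewrite !rmorphM /= centreP. Qed.

HB.instance Definition _ := GRing.PzRing_hasCommutativeMul.Build centre centre_mulC.

Definition to_centre (x : K) : centre := insubd 0 x.

Lemma to_centreK (x : K) : central x -> val (to_centre x) = x.
Proof. by move=> xC; rewrite /to_centre insubdK //; apply/asboolP. Qed.

Hypothesis divK : is_division_ring K.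

Fact centre_field_axiom : GRing.field_axiom centre.
Proof.
move=> x x0; have vx0 : val x != 0 by rewrite -(rmorph0 (val : centre -> K)) (inj_eq val_inj).
apply/unitrP; have Ux := divK vx0.
have VC : central (val x)^-1 by apply: centralV; apply: centreP.
exists (to_centre (val x)^-1).
by split; apply: val_inj; rewrite rmorphM /= to_centreK // ?mulVr ?mulrV.
Qed.

Definition centre_field : fieldType :=
  HB.pack centre (GRing.ComUnitRing_isField.Build centre centre_field_axiom).

End Centre.

(* The argument [divK] makes the scalar field recoverable from the type. *)
Definition centre_matrix (K : unitRingType) (divK : is_division_ring K) (n : nat) : Type :=
  'M[K]_n.+1.

Section MatrixAlgebra.
Variables (K : unitRingType) (divK : is_division_ring K) (n : nat).

Local Notation F := (centre_field divK).

Local Notation MK := (centre_matrix divK n).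

HB.instance Definition _ := GRing.NzRing.on MK.

Definition centre_scale (c : F) (x : MK) : MK :=
  (val (c : centre K) *: (x : 'M[K]_n.+1)).

Fact centre_scaleA c d x : centre_scale c (centre_scale d x) = centre_scale (c * d) x.
Proof. by rewrite /centre_scale scalerA. Qed.

Fact centre_scale1 : left_id 1 centre_scale.
Proof. by move=> x; rewrite /centre_scale scale1r. Qed.

Fact centre_scaleDr : right_distributive centre_scale +%R.
Proof. by move=> c x y; rewrite /centre_scale scalerDr. Qed.

Fact centre_scaleDl x : {morph centre_scale^~ x : c d / c + d}.
Proof. by move=> c d; rewrite /centre_scale scalerDl. Qed.

HB.instance Definition _ := GRing.Zmodule_isLmodule.Build F MK
  centre_scaleA centre_scale1 centre_scaleDr centre_scaleDl.

Fact centre_scaleAl (c : F) (x y : MK) : c *: (x * y) = c *: x * y.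
Proof. exact: scalemxAl. Qed.

HB.instance Definition _ := GRing.Lmodule_isLalgebra.Build F MK centre_scaleAl.

Fact centre_scaleAr (c : F) (x y : MK) : c *: (x * y) = x * (c *: y).
Proof.
apply/matrixP => i j; rewrite !mxE mulr_sumr; apply: eq_bigr => k _.
by rewrite !mxE !mulrA centreP.
Qed.

HB.instance Definition _ := GRing.Lalgebra_isAlgebra.Build F MK centre_scaleAr.

End MatrixAlgebra.

(** * Coordinate operators on matrix algebras *)

Section Certificate.
Variables (K : unitRingType) (divK : is_division_ring K).
Variables (m : nat) (bK : 'I_m -> K) (LK : 'I_m -> seq (K * K)).
Hypothesis span_bK : central_span bK.
Hypothesis LKb : forall i j, mulop (LK i) (bK j) = (i == j)%:R.
Variable n : nat.

Local Notation F := (centre_field divK).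
Local Notation MK := (centre_matrix divK n).

Lemma mulop_sum (A : pzRingType) (l : seq (A * A)) (I : Type) (s : seq I) (E : I -> A) :
  mulop l (\sum_(i <- s) E i) = \sum_(i <- s) mulop l (E i).
Proof. by apply: (big_morph (mulop l)); [exact: mulopD | exact: mulop0]. Qed.

Let coordinateE (c : 'I_m -> K) i : (forall j, central (c j)) ->
  mulop (LK i) (\sum_j c j * bK j) = c i.
Proof.
move=> cC; rewrite mulop_sum (bigD1 i) //= (mulop_central _ _ (cC i)) LKb eqxx mulr1.
rewrite big1 ?addr0 // => j ne_ji.
by rewrite (mulop_central _ _ (cC j)) LKb eq_sym (negbTE ne_ji) mulr0.
Qed.

Lemma coordinate_central x i : central (mulop (LK i) x).
Proof. by have [c [cC ->]] := span_bK x; rewrite coordinateE. Qed.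

Lemma coordinate_span x : x = \sum_i mulop (LK i) x * bK i.
Proof.
have [c [cC E]] := span_bK x; rewrite [LHS]E; apply: eq_bigr => i _.
by rewrite E coordinateE.
Qed.

Let T : finType := ('I_n.+1 * 'I_n.+1 * 'I_m)%type.

Definition mx_basis (t : T) : MK := bK t.2 *: delta_mx t.1.1 t.1.2.

(** Rests on the identity that the sum over [r] of [E_rp u z v E_qr] is the scalar matrix of
    [u z_pq v], with [E] the matrix units; this carries the operators of [K] over to matrices. *)
Definition mx_ops (t : T) : seq (MK * MK) :=
  flatten [seq [seq (delta_mx r t.1.1 *m p.1%:M, p.2%:M *m delta_mx t.1.2 r) | p <- LK t.2]
    | r <- enum 'I_n.+1].

Definition mx_coord (z : MK) (t : T) : F := to_centre (mulop (LK t.2) (z t.1.1 t.1.2)).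

Lemma val_mx_coord z t : val (mx_coord z t : centre K) = mulop (LK t.2) (z t.1.1 t.1.2).
Proof. by rewrite to_centreK //; apply: coordinate_central. Qed.

Lemma mx_basis_span z : z = \sum_t mx_coord z t *: mx_basis t.
Proof.
rewrite [LHS]matrix_sum_delta pair_big /=.
rewrite [RHS](eq_bigr (fun t : T => val (mx_coord z (t.1, t.2) : centre K) *:
  mx_basis (t.1, t.2))); last by case.
rewrite -(pair_bigA _ (fun (pq : 'I_n.+1 * 'I_n.+1) (i : 'I_m) =>
  val (mx_coord z (pq, i) : centre K) *: mx_basis (pq, i))) /=.
apply: eq_bigr => -[p q] _ /=.
rewrite {1}(coordinate_span (z p q)) scaler_suml; apply: eq_bigr => i _.
by rewrite val_mx_coord /mx_basis scalerA.
Qed.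

Let delta_mulE (r p : 'I_n.+1) (M : 'M[K]_n.+1) i j :
  (delta_mx r p *m M) i j = (i == r)%:R * M p j.
Proof.
rewrite mxE (bigD1 p) //= big1 => [|k ne_kp]; rewrite !mxE ?eqxx ?andbT ?addr0 //.
by rewrite (negbTE ne_kp) andbF mul0r.
Qed.

Let mul_deltaE (q r : 'I_n.+1) (M : 'M[K]_n.+1) i j :
  (M *m delta_mx q r) i j = M i q * (j == r)%:R.
Proof.
rewrite mxE (bigD1 q) //= big1 => [|k ne_kq]; rewrite !mxE ?eqxx ?addr0 //.
by rewrite (negbTE ne_kq) mulr0.
Qed.

Let mul_scalarE (v : K) (M : 'M[K]_n.+1) i j : (M *m v%:M) i j = M i j * v.
Proof.
rewrite mxE (bigD1 j) //= big1 => [|k ne_kj]; rewrite !mxE ?eqxx ?addr0 ?mulr1n //.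
by rewrite (negbTE ne_kj) mulr0n mulr0.
Qed.

Let unit_opE (r p q : 'I_n.+1) (u v : K) (z : 'M[K]_n.+1) i j :
  (delta_mx r p *m u%:M *m z *m (v%:M *m delta_mx q r)) i j =
  (i == r)%:R * (u * z p q * v) * (j == r)%:R.
Proof.
by rewrite mulmxA mul_deltaE mul_scalarE -mulmxA delta_mulE mul_scalar_mx mxE !mulrA.
Qed.

Lemma mx_ops_coord z t : mulop (mx_ops t) z = (mx_coord z t)%:A.
Proof.
rewrite mulop_flatten big_enum /=; apply/matrixP => i j.
have -> : ((mx_coord z t)%:A : MK) i j = mulop (LK t.2) (z t.1.1 t.1.2) * (i == j)%:R.
  by rewrite -val_mx_coord !mxE.
rewrite summxE (eq_bigr (fun r => (i == r)%:R * mulop (LK t.2) (z t.1.1 t.1.2) * (j == r)%:R)).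
  rewrite (bigD1 i) //= eqxx mul1r big1 ?addr0 1?[j == i]eq_sym // => r ne_ri.
  by rewrite eq_sym (negbTE ne_ri) !mul0r.
move=> r _; rewrite /mulop big_map summxE mulr_sumr mulr_suml.
by apply: eq_bigr => p _; rewrite unit_opE.
Qed.

Lemma mx_coord_basis t t' : mx_coord (mx_basis t) t' = (t == t')%:R.
Proof.
apply: val_inj; rewrite val_mx_coord /mx_basis /= !mxE.
case: t t' => [[p q] i] [[p' q'] i'] /=.
have -> : ((p, q, i) == (p', q', i')) = (p' == p) && (q' == q) && (i' == i).
  by rewrite !xpair_eqE (eq_sym p) (eq_sym q) (eq_sym i).
case: (p' == p); case: (q' == q) => /=; rewrite ?mulr0 ?mulop0 ?rmorph0 //.
by rewrite mulr1 LKb; case: (i' == i); rewrite ?rmorph1 ?rmorph0.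
Qed.

End Certificate.

Lemma centre_matrix_certificate (K : unitRingType) (divK : is_division_ring K)
    m (bK : 'I_m -> K) n :
  central_span bK ->
  exists d (b : 'I_d -> centre_matrix divK n)
    (L : 'I_d -> seq (centre_matrix divK n * centre_matrix divK n))
    (zeta : centre_matrix divK n -> 'I_d -> centre_field divK),
  [/\ forall z, z = \sum_j zeta z j *: b j,
      forall z j, mulop (L j) z = (zeta z j)%:A &
      forall i j, zeta (b i) j = (i == j)%:R].
Proof.
move=> span; have [m' [b' [span' free']]] := central_basis divK span.
have [|LK LKb] := artin_whaples _ free'.
  by move=> x /divK Ux; exists x^-1; rewrite mulVr.
pose T : finType := ('I_n.+1 * 'I_n.+1 * 'I_m')%type.
pose b (i : 'I_#|T|) := @mx_basis K divK m' b' n (enum_val i).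
pose L (i : 'I_#|T|) := @mx_ops K divK m' LK n (enum_val i).
pose zeta z (i : 'I_#|T|) := @mx_coord K divK m' LK n z (enum_val i).
exists #|T|, b, L, zeta; split.
- move=> z; rewrite [LHS](mx_basis_span span' LKb z).
  by rewrite [LHS](reindex (@enum_val _ T)) //=; apply/onW_bij/enum_val_bij.
- by move=> z j; rewrite /L /zeta; exact: (mx_ops_coord span' LKb).
- by move=> i j; rewrite /zeta (mx_coord_basis divK span' LKb) (inj_eq enum_val_inj).
Qed.

(** * Fields that are not locally finite *)

Section FiniteEmbedding.
Variables (F : fieldType) (R : subringClosed F) (k : finFieldType) (psi : F -> k).
Hypotheses (psiH : hom_on R psi) (ker0 : forall r, r \in R -> psi r = 0 -> r = 0).

Lemma embedding_inj : {in R &, injective psi}.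
Proof.
move=> x y Rx Ry e; apply/eqP; rewrite -subr_eq0; apply/eqP/ker0; first exact: rpredB.
by rewrite (hom_onB psiH) // e subrr.
Qed.

Lemma embedding_enum : exists s : seq F, forall x, x \in R -> x \in s.
Proof.
have [y|f fP] := @choice k F (fun y x => forall z, z \in R -> psi z = y -> z = x).
  have [[x [Rx <-]]|no] := pselect (exists x, x \in R /\ psi x = y).
    by exists x => z Rz; apply: embedding_inj.
  by exists 0 => z Rz e; case: no; exists z.
exists [seq f y | y <- enum k] => x Rx; apply/mapP; exists (psi x); first by rewrite mem_enum.
exact: fP.
Qed.

Lemma embedding_inv x : x \in R -> x^-1 \in R.
Proof.
move=> Rx; have [->|x0] := eqVneq x 0; first by rewrite invr0 rpred0.
have px : psi x != 0 by apply: contraNneq x0 => /(ker0 Rx) ->.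
have [psi1 _ _] := psiH; have RX : x ^+ #|k|.-1 \in R by rewrite rpredX.
have /eqP : x ^+ #|k|.-1 = 1.
  apply: embedding_inj; rewrite ?rpred1 // (hom_onX psiH) // expf_pred_card //.
rewrite -(prednK (pred_card_gt0 k)) exprS => /eqP xX.
suff -> : x^-1 = x ^+ #|k|.-2 by rewrite rpredX.
by apply: (mulfI x0); rewrite xX mulfV.
Qed.

End FiniteEmbedding.

Lemma no_finite_embeddingPn (F : fieldType) : ~ no_finite_embedding F ->
  forall l0 : seq F, exists (R : subringClosed F) (k : finFieldType) (psi : F -> k),
  [/\ {subset l0 <= R}, hom_on R psi & forall r, r \in R -> psi r = 0 -> r = 0].
Proof.
move=> fin l0; apply: contrapT => no; apply: fin; exists l0 => R l0R k psi psiH.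
apply: contrapT => inj; apply: no; exists R, k, psi; split=> // r Rr pr.
by apply: contrapT => /eqP r0; apply: inj; exists r.
Qed.

(** If finitely many central elements always lay in a finite ring, [x] and [y] would lie in a
    lattice over such a ring [R], a finite domain, and would commute by Wedderburn. *)
Lemma noncommutative_no_finite_embedding (K : unitRingType) (divK : is_division_ring K)
    m (bK : 'I_m -> K) :
  central_span bK -> ~ is_commutative K -> no_finite_embedding (centre_field divK).
Proof.
move=> span nc; apply: contrapT => /no_finite_embeddingPn fin; apply: nc => x y.
(* Index 0 means 1 by 1 matrices, which stand for [K] itself. *)
have [d [b [L [zeta [zeta_span zeta_op zeta_b]]]]] := centre_matrix_certificate divK 0 span.
pose A := centre_matrix divK 0.
pose xM : A := x%:M; pose yM : A := y%:M.
pose co (z : A) := [seq zeta z j | j <- enum 'I_d].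
have coP z j : zeta z j \in co z by apply: map_f; rewrite mem_enum.
have [R [k [psi [gensR psiH ker0]]]] := fin (flatten [:: co 1; co xM; co yM;
  flatten [seq co (b i * b j) | i <- enum 'I_d, j <- enum 'I_d]]).
have R1 j : zeta 1 j \in R.
  by apply: gensR; apply/flattenP; exists (co 1); rewrite ?inE ?eqxx.
have Rx : xM \in lat zeta R.
  by apply/latP => j; apply: gensR; apply/flattenP; exists (co xM); rewrite ?inE ?eqxx ?orbT.
have Ry : yM \in lat zeta R.
  by apply/latP => j; apply: gensR; apply/flattenP; exists (co yM); rewrite ?inE ?eqxx ?orbT.
have Rb i j l : zeta (b i * b j) l \in R.
  apply: gensR; apply/flattenP.
  exists (flatten [seq co (b i * b j) | i <- enum 'I_d, j <- enum 'I_d]).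
    by rewrite !inE eqxx !orbT.
  apply/flattenP; exists (co (b i * b j)) => //.
  by apply/allpairsP; exists (i, j); rewrite !mem_enum.
have [s sP] := embedding_enum psiH ker0.
pose lR := [seq z <- [seq \sum_j ssval (f j) *: b j | f : {ffun 'I_d -> seq_sub s}]
  | z \in lat zeta R].
have lRP z : (z \in lR) = (z \in lat zeta R).
  rewrite mem_filter andb_idr // => /latP Rz; apply/mapP.
  exists [ffun j => SeqSub (sP _ (Rz j))]; first by rewrite mem_enum.
  by rewrite [LHS]zeta_span; apply: eq_bigr => j _; rewrite ffunE.
have := @finite_domain_comm A 1 lR; rewrite /prop_in2 /=.
have RR : {subset R <= R} by [].
move=> /(_ _ _ _ _ _ _ _ xM yM) comm.
have : xM * yM = yM * xM.
  apply: comm; rewrite ?lRP ?oner_neq0 //.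
  - exact: (lat1 R1 RR).
  - by move=> z w; rewrite !lRP; apply: (latB zeta_op).
  - by move=> z w; rewrite !lRP; apply: (latM zeta_span zeta_op Rb RR).
  - by move=> z _; rewrite mul1r.
  - by move=> z _; rewrite mulr1.
  move=> z w _ _ zw.
  have e (v : A) : v = (v 0 0)%:M :> 'M[K]_1 by rewrite [LHS]mx11_scalar.
  have zw0 : z 0 0 * w 0 0 = 0.
    by have := congr1 (fun M : 'M[K]_1 => M 0 0) zw; rewrite !mxE big_ord1.
  have [z0|z0] := eqVneq (z 0 0) 0.
    by left; rewrite [LHS]e z0 -[0%:M]/(scalar_mx 0) raddf0.
  right; rewrite [LHS]e; have -> : w 0 0 = 0.
    by rewrite -[LHS](mulKr (divK _ z0)) zw0 mulr0.
  by rewrite -[0%:M]/(scalar_mx 0) raddf0.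
move/(congr1 (fun M : 'M[K]_1 => M 0 0)).
by rewrite !mxE !big_ord1 !mxE eqxx !mulr1n.
Qed.

(** * Almost subnormal subgroups *)

Lemma step_inverse (A : pzRingType) (a a' : A) p s :
  inverse_pair (a, a') -> inverse_pair p -> inverse_pair (step a a' p s).
Proof.
case=> /= aa' a'a [/= xx' x'x]; case: s => [e|]; split=> /=.
- by rewrite -exprMn_comm ?xx' ?expr1n // /GRing.comm xx' x'x.
- by rewrite -exprMn_comm ?x'x ?expr1n // /GRing.comm xx' x'x.
- by rewrite -!mulrA (mulrA p.2) x'x mul1r (mulrA a') a'a mul1r (mulrA p.1) xx' mul1r.
- by rewrite -!mulrA (mulrA a') a'a mul1r (mulrA p.2) x'x mul1r (mulrA a) aa' mul1r.
Qed.

Lemma run_inverse (A : pzRingType) (a a' : A) l p :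
  inverse_pair (a, a') -> inverse_pair p -> inverse_pair (run a a' l p).
Proof.
move=> ha; elim: l p => //= s l IHl p hp; apply: IHl; exact: step_inverse.
Qed.

Lemma run_morph (A C : pzRingType) (f : {rmorphism A -> C}) (a a' : A) l p :
  run (f a) (f a') l (f p.1, f p.2) = (f (run a a' l p).1, f (run a a' l p).2).
Proof.
elim: l p => //= s l IHl p; rewrite -IHl; congr (run _ _ _ _).
by case: s => [e|] /=; rewrite ?rmorphXn ?rmorphM.
Qed.

Section AlmostSubnormal.
Variables (D : unitRingType) (n : nat).
Local Notation M := 'M[D]_n.+1.
Implicit Types (H : M -> Prop) (a x : M).

Lemma subgroupX H x i : is_subgroup_GL H -> H x -> H (x ^+ i).
Proof.
case=> _ H1 HM _ Hx; elim: i => [|i IHi]; first by rewrite expr0.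
by rewrite exprS; apply: HM.
Qed.

Lemma inverse_unique x y z : inv_pair x y -> inv_pair x z -> y = z.
Proof. by case=> _ yx [xz _]; rewrite -[y]mulmx1 -xz mulmxA yx mul1mx. Qed.

Lemma subgroupV H x y : is_subgroup_GL H -> H x -> inv_pair x y -> H y.
Proof.
by case=> _ _ _ HV /HV [z [Hz xz]] xy; rewrite (inverse_unique xy xz).
Qed.

(** Two of the powers of [x] with exponents 0 to [size s] lie in the same coset, so [x ^+ (j - i)]
    is in [H]. The gap depends on [x], but always divides the factorial of [size s]. *)
Lemma finite_index_power H K : is_subgroup_GL H -> is_subgroup_GL K ->
  finite_index_in H K -> exists e, forall x, K x -> H (x ^+ e.+1).
Proof.
move=> gH gK [s [sK sP]]; exists (size s)`!.-1 => x Kx.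
rewrite prednK ?fact_gt0 //.
have [c cP] : exists c : nat -> M, forall i, c i \in s /\ exists h, H h /\ x ^+ i = c i *m h.
  have [i|c cP] := @choice nat M (fun i g => g \in s /\ exists h, H h /\ x ^+ i = g *m h).
    by apply: sP; apply: subgroupX.
  by exists c.
have [i [j [lt_ij le_j eq_c]]] : exists i j, [/\ (i < j)%N, (j <= size s)%N & c i = c j].
  apply: contrapT => no; have := @uniq_leq_size _ [seq c i | i <- iota 0 (size s).+1] s.
  rewrite size_map size_iota ltnn => h; suff : false by []; apply: h.
    rewrite map_inj_in_uniq ?iota_uniq // => i j; rewrite !mem_iota /= !add0n !ltnS => li lj e.
    by case: (ltngtP i j) => // lt; case: no; [exists i, j | exists j, i].
  by move=> _ /mapP [i _ ->]; case: (cP i).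
have [cs [h [Hh xi]]] := cP i; have [_ [h' [Hh' xj]]] := cP j.
have [GK _ _ _] := gK; have [gi giP] := GK _ (sK _ cs).
have [_ _ HM HV] := gH; have [hi [Hhi hP]] := HV _ Hh.
have xji : x ^+ (j - i) = hi *m h'.
  have [_ gic] := giP; have [_ hih] := hP.
  have : gi *m x ^+ j = gi *m (x ^+ i *m x ^+ (j - i)).
    by rewrite -[_ *m x ^+ (j - i)]/(x ^+ i * x ^+ (j - i)) -exprD subnKC // ltnW.
  rewrite xj -eq_c xi !mulmxA gic !mul1mx => ->.
  by rewrite mulmxA hih mul1mx.
have : (j - i %| (size s)`!)%N.
  by apply: dvdn_fact; rewrite subn_gt0 lt_ij (leq_trans (leq_subr _ _)).
case/dvdnP=> q ->; rewrite mulnC exprM; apply: subgroupX => //.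
by rewrite xji; apply: HM.
Qed.

(** At a normal step [[a, x]] is [a] times a conjugate of its inverse, both in the smaller group; at
    a step of finite index a power suffices. The word depends on the chain only, so one word serves
    both generators. *)
Lemma almost_subnormal_run (N : M -> Prop) (a a' : M) :
  almost_subnormal_GL N -> N a -> inv_pair a a' ->
  exists l, forall x x', inverse_pair (x, x') -> N (run a a' l (x, x')).1.
Proof.
case=> r [H [H0 [Hr [Hsub Hstep]]]] Na aa'.
have aH i : (i <= r)%N -> H i a.
  move=> le_ir; rewrite -(subKn le_ir); elim: (r - i)%N => [|j IHj].
    by rewrite subn0; apply/Hr.
  case: (ltnP j r) => [lt_jr|le_rj].
    have [sub _] := Hstep (r - j.+1)%N (ltac:(lia)).
    by apply: sub; have -> : (r - j.+1).+1 = (r - j)%N by lia.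
  have -> : (r - j.+1 = r - j)%N by lia.
  done.
suff : forall i, (i <= r)%N ->
    exists l, forall x x', inverse_pair (x, x') -> H i (run a a' l (x, x')).1.
  by case/(_ r (leqnn r)) => l lP; exists l => x x' xx'; apply/Hr/lP.
elim=> [|i IHi] lt_ir.
  by exists [::] => x x' [xx' x'x]; apply/H0; exists x'.
have [l lP] := IHi (ltnW lt_ir).
have gH := Hsub i (ltnW lt_ir); have gH' := Hsub i.+1 lt_ir.
have ha : inverse_pair (a, a') by case: aa'.
have [sub [nor|fin]] := Hstep i lt_ir.
  exists (rcons l None) => x x' xx'.
  rewrite /run -cats1 foldl_cat /=; set p := foldl _ _ _.
  have Hp : H i p.1 := lP _ _ xx'.
  have pp : inverse_pair p by apply: run_inverse.
  have Hp' : H i p.2 by apply: (subgroupV gH Hp).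
  have Ha' : H i.+1 a' by apply: (subgroupV gH' (aH _ lt_ir)).
  have [_ _ HM _] := gH'.
  rewrite -[_ * _ * _ * _]/(a *m p.1 *m a' *m p.2) -!mulmxA; apply: HM; first exact: aH.
  by rewrite mulmxA; apply: nor Hp' _ Ha'; case: pp.
have [e eP] := finite_index_power gH' gH fin.
exists (rcons l (Some e)) => x x' xx'.
by rewrite /run -cats1 foldl_cat /=; apply/eP/lP.
Qed.

End AlmostSubnormal.

(** * Division subrings and the main theorem *)

Section SubDivisionRing.
Variables (D : unitRingType) (S : divringClosed D).

Definition sub_ring := {x : D | x \in S}.
HB.instance Definition _ := SubChoice.on sub_ring.
HB.instance Definition _ := [SubChoice_isSubUnitRing of sub_ring by <:].

Definition in_sub (x : D) (Sx : x \in S) : sub_ring := exist _ x Sx.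

Definition to_sub (x : D) : sub_ring := insubd 0 x.

Lemma to_subK x : x \in S -> val (to_sub x) = x.
Proof. by move=> Sx; rewrite /to_sub insubdK. Qed.

Lemma sub_ring_division : is_division_ring D -> is_division_ring sub_ring.
Proof.
move=> divD x x0; have vx0 : val x != 0.
  by rewrite -(rmorph0 (val : sub_ring -> D)) (inj_eq val_inj).
have Ux := divD _ vx0; have Sx : (val x)^-1 \in S by rewrite rpredV; apply: valP.
apply/unitrP; exists (in_sub Sx).
by split; apply: val_inj; rewrite rmorphM /= ?mulVr ?mulrV ?rmorph1.
Qed.

End SubDivisionRing.

Lemma gen_division_subring_closed (D : unitRingType) (s : seq D) :
  is_division_subring (gen_division_subring s).
Proof.
split=> [P [P1 _ _ _] _|x y gx gy P PS sP|x y gx gy P PS sP|x gx x0 P PS sP] //.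
- by have [_ PB _ _] := PS; apply: PB; [apply: gx | apply: gy].
- by have [_ _ PM _] := PS; apply: PM; [apply: gx | apply: gy].
- by have [_ _ _ PV] := PS; apply: PV => //; apply: gx.
Qed.

Definition gen_pred (D : unitRingType) (s : seq D) : {pred D} :=
  fun x => `[< gen_division_subring s x >].

Fact gen_pred_divring (D : unitRingType) (s : seq D) : divring_closed (gen_pred s).
Proof.
have [g1 gB gM gV] := gen_division_subring_closed s.
split=> [|x y /asboolP gx /asboolP gy|x y /asboolP gx /asboolP gy]; apply/asboolP => //.
- exact: gB.
- apply: gM => //; have [->|y0] := eqVneq y 0; last exact: gV.
  by rewrite invr0 -(subrr 1); apply: gB.
Qed.

HB.instance Definition _ (D : unitRingType) (s : seq D) :=
  GRing.isDivringClosed.Build D (gen_pred s) (gen_pred_divring s).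

Lemma gen_pred_sub (D : unitRingType) (s : seq D) : {subset s <= gen_pred s}.
Proof. by move=> x sx; apply/asboolP => P _; apply. Qed.

Lemma gen_central_span (D : unitRingType) (s : seq D) :
  fin_dim_over_center (gen_division_subring s) ->
  exists m (bK : 'I_m -> sub_ring (gen_pred s : divringClosed D)), central_span bK.
Proof.
case=> b [Kb span]; pose K := sub_ring (gen_pred s : divringClosed D).
have bK_sub (i : 'I_(size b)) : b`_i \in gen_pred s by apply/asboolP; apply: Kb; apply: ltn_ord.
exists (size b), (fun i => in_sub (bK_sub i) : K) => x.
have [|c [cC Ex]] := span (val x); first exact/asboolP/(valP x).
have cS (i : 'I_(size b)) : c i \in gen_pred s by apply/asboolP; case: (cC i (ltn_ord i)).
exists (fun i => in_sub (cS i)); split=> [i y|].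
  apply: val_inj; rewrite !rmorphM /=; have [_ ->] := cC i (ltn_ord i) => //.
  exact/asboolP/(valP y).
by apply: val_inj; rewrite Ex rmorph_sum; apply: eq_bigr => i _; rewrite rmorphM /=.
Qed.

(** [S0] is thrown into the generators of the division subring, so that whatever witnesses the
    failure of local finiteness in [D] is present in it. The entries of [g] are included to keep [a]
    non-central. *)
Lemma free_subgroup_over_subring (D : unitRingType) n (N : 'M[D]_n.+1 -> Prop) (S0 : seq D) :
  is_division_ring D -> weakly_locally_finite D ->
  is_subgroup_GL N -> almost_subnormal_GL N -> non_central_GL N ->
  (forall (S : divringClosed D) (divS : is_division_ring (sub_ring S)) m (bK : 'I_m -> sub_ring S),
     {subset S0 <= S} -> central_span bK -> no_finite_embedding (centre_field divS)) ->
  has_noncyclic_free_subgroup N.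
Proof.
move=> divD wlf gN asN [a [g [Na [_ ag]]]] nlf.
have [NGL N1 NM NV] := gN.
have [a' aa'] := NGL _ Na; have [aa'1 a'a1] := aa'.
have Na' : N a' by apply: (subgroupV gN Na).
pose entries (x : 'M[D]_n.+1) := [seq x ij.1 ij.2 | ij : 'I_n.+1 * 'I_n.+1].
pose s := S0 ++ entries a ++ entries a' ++ entries g.
pose S : divringClosed D := gen_pred s; pose K := sub_ring S.
have divK : is_division_ring K by apply: sub_ring_division.
have [m [bK span]] := gen_central_span (wlf s).
have nlfK : no_finite_embedding (centre_field divK).
  by apply: nlf span => x xs; apply: gen_pred_sub; rewrite mem_cat xs.
pose toK (x : 'M[D]_n.+1) : 'M[K]_n.+1 := map_mx (@to_sub D S) x.
have [ofK ofKE] : exists f : {rmorphism 'M[K]_n.+1 -> 'M[D]_n.+1},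
    forall x i j, f x i j = val (x i j).
  by exists (map_mx (val : K -> D)) => x i j; rewrite mxE.
have toK_K x : {subset entries x <= s} -> ofK (toK x) = x.
  move=> xs; apply/matrixP => i j; rewrite ofKE mxE to_subK //.
  by apply: gen_pred_sub; apply: xs; apply/mapP; exists (i, j); rewrite ?mem_enum.
have ofK_inj : injective ofK.
  by move=> x y /matrixP e; apply/matrixP => i j; apply: val_inj; have := e i j; rewrite !ofKE.
have aK : ofK (toK a) = a by apply: toK_K => x xs; rewrite !mem_cat xs orbT.
have a'K : ofK (toK a') = a' by apply: toK_K => x xs; rewrite !mem_cat xs !orbT.
have gK : ofK (toK g) = g by apply: toK_K => x xs; rewrite !mem_cat xs !orbT.
have [l lP] := almost_subnormal_run asN Na aa'.
have [d [b [L [zeta [zeta_span zeta_op zeta_b]]]]] := centre_matrix_certificate divK n span.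
have [|||y [j [yP free]]] := @algebra_free_pair _ _ d b L zeta zeta_span zeta_op zeta_b
  (toK a : centre_matrix divK n) (toK a') (toK g) l nlfK.
- by apply: ofK_inj; rewrite rmorphM rmorph1 aK a'K.
- by apply: ofK_inj; rewrite rmorphM rmorph1 aK a'K.
- by move/(congr1 ofK); rewrite !rmorphM aK gK.
pose r i := run (toK a) (toK a') (None :: l) (y i).
pose z i := (toK a' ^+ j i * (r i).1 * toK a ^+ j i, toK a' ^+ j i * (r i).2 * toK a ^+ j i).
have zE i : (ofK (z i).1 = a' ^+ j i * ofK (r i).1 * a ^+ j i) *
            (ofK (z i).2 = a' ^+ j i * ofK (r i).2 * a ^+ j i).
  by rewrite /z /= !rmorphM !rmorphXn /= aK a'K.
have rE i : (ofK (r i).1, ofK (r i).2) = run a a' (None :: l) (ofK (y i).1, ofK (y i).2).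
  by rewrite -aK -a'K run_morph.
have ofK_inv p : inverse_pair p -> inverse_pair (ofK p.1, ofK p.2).
  by case=> xx' x'x; split; rewrite /= -rmorphM ?xx' ?x'x rmorph1.
have ha : inverse_pair (a, a') by [].
have rP i : inverse_pair (ofK (r i).1, ofK (r i).2).
  by rewrite rE; apply: run_inverse => //; apply: ofK_inv.
(* The additional commutator in front is harmless: [lP] holds for every invertible start, in
   particular for [[a, y]]. *)
have rN i : N (ofK (r i).1).
  have -> : ofK (r i).1 = (run a a' (None :: l) (ofK (y i).1, ofK (y i).2)).1 by rewrite -rE.
  by apply: lP; apply: (@step_inverse _ a a' (_, _) None) => //; apply: ofK_inv.
have aXX i : (a ^+ i * a' ^+ i = 1) * (a' ^+ i * a ^+ i = 1).
  have aa : a * a' = 1 := aa'1; have a'a : a' * a = 1 := a'a1.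
  by rewrite -!exprMn_comm ?aa ?a'a ?expr1n // /GRing.comm aa a'a.
exists bool, (fun i => ofK (z i).1), (fun i => ofK (z i).2); split; first by exists true, false.
split=> [i|w w0 redw e].
  rewrite !zE; split.
    by apply: (NM); [apply: (NM) => // |]; apply: subgroupX.
  have [r1 r2] := rP i; rewrite /= in r1 r2; split.
    rewrite -[LHS]/(_ * _) -!mulrA (mulrA (a ^+ j i)) aXX mul1r.
    by rewrite (mulrA (ofK (r i).1)) r1 mul1r aXX.
  rewrite -[LHS]/(_ * _) -!mulrA (mulrA (a ^+ j i)) aXX mul1r.
  by rewrite (mulrA (ofK (r i).2)) r2 mul1r aXX.
apply: (free w w0 redw); apply: ofK_inj; rewrite rmorph1 -[RHS]e -/(z).
elim: w {w0 redw e} => [|[i s'] w IHw]; first by rewrite /= rmorph1.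
by rewrite [in RHS]/= -IHw /= rmorphM; case: s'.
Qed.

Theorem theorem4p3 (D : unitRingType) (n : nat) (N : 'M[D]_n -> Prop) :
  is_division_ring D ->
  weakly_locally_finite D ->
  (0 < n)%N ->
  is_subgroup_GL N ->
  almost_subnormal_GL N ->
  non_central_GL N ->
  (~ is_commutative D \/ n = 1%N \/ ((2 <= n)%N /\ ~ locally_finite_field D)) ->
  has_noncyclic_free_subgroup N.
Proof.
case: n N => // n N divD wlf _ gN asN ncN cond.
have [comD|ncD] := pselect (is_commutative D); last first.
  have [x [y xy]] : exists x y : D, x * y <> y * x.
    apply: contrapT => no; apply: ncD => x y.
    by apply: contrapT => xy; apply: no; exists x, y.
  apply: (@free_subgroup_over_subring D n N [:: x; y]) => // S divS m bK xyS span.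
  apply: noncommutative_no_finite_embedding span _ => comS; apply: xy.
  have Sx : x \in S by apply: xyS; rewrite inE eqxx.
  have Sy : y \in S by apply: xyS; rewrite !inE eqxx orbT.
  by have /(congr1 val) := comS (in_sub Sx) (in_sub Sy).
(* Over a commutative [D] matrices of size 1 commute, so a non-central [N] leaves only the third
   condition. *)
have [_ nlf] : (2 <= n.+1)%N /\ ~ locally_finite_field D.
  case: cond => [//|[[n0]|//]]; subst n; have [x [g [_ [_ xg]]]] := ncN.
  case: xg; apply/matrixP => i j; rewrite !mxE !big_ord1 !ord1; exact: comD.
have [S0 S0P] : exists S0 : seq D, ~ exists l : seq D, forall x,
    gen_division_subring S0 x <-> x \in l.
  apply: contrapT => no; apply: nlf; split=> // S.
  by apply: contrapT => nl; apply: no; exists S.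
apply: (@free_subgroup_over_subring D n N S0) => // S divS m bK S0S _.
apply: contrapT => /no_finite_embeddingPn fin; apply: S0P.
have comS (x : sub_ring S) : central x by move=> y; apply: val_inj; rewrite !rmorphM /= comD.
pose emb (x : D) : centre (sub_ring S) := to_centre (to_sub S x).
have embK x : x \in S -> val (val (emb x)) = x.
  by move=> Sx; rewrite to_centreK // to_subK.
have [R [k [psi [S0R psiH ker0]]]] := fin [seq emb x | x <- S0].
have [s sP] := embedding_enum psiH ker0.
(* A subring embedded in a finite field is a finite field; its image in [D] is a finite division
   subring containing [S0], against the choice of [S0]. *)
pose P x := exists2 y : centre (sub_ring S), y \in R & val (val y) = x.
have PS : is_division_subring P.
  split.
  - by exists 1; rewrite ?rpred1 ?rmorph1.
  - by move=> _ _ [x Rx <-] [y Ry <-]; exists (x - y); rewrite ?rpredB ?rmorphB.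
  - by move=> _ _ [x Rx <-] [y Ry <-]; exists (x * y); rewrite ?rpredM ?rmorphM.
  move=> _ [x Rx <-] x0; exists x^-1; first exact: embedding_inv psiH ker0 _ Rx.
  have Ux := divD _ x0.
  have x'0 : x != 0 by apply: contraNneq x0 => ->; rewrite !rmorph0.
  by apply: (mulIr Ux); rewrite mulVr // -!rmorphM mulVf ?rmorph1.
have genP x : gen_division_subring S0 x -> P x.
  move=> gx; apply: gx => // t S0t; exists (emb t); last by rewrite embK // S0S.
  by apply: S0R; apply: map_f.
exists [seq x <- [seq val (val (y : centre (sub_ring S))) | y <- s]
  | `[< gen_division_subring S0 x >]].
move=> x; rewrite mem_filter; split=> [gx|/andP [/asboolP]//].
apply/andP; split; first exact/asboolP.
by have [y Ry <-] := genP x gx; apply: map_f; apply: sP.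
Qed.
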